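(* Suppose $\beta>0$, $\boldsymbol{B}\in\mathbb{R}^{q-1}$ with $\boldsymbol{B}\neq\boldsymbol{0}$, and $\boldsymbol{X}\in[q]^N$ is an observation from the Potts model $\mathbb{P}_{\beta,\boldsymbol{B}}$, where the interaction matrix $\boldsymbol{A}_N$ satisfies $$\sup_{N\ge1}\max_{i\in[N]}\sum_{j=1}^Na_{ij}<\infty,\qquad \liminf_{N\to\infty}\frac1N\sum_{1\le i,j\le N}a_{ij}>0,\qquad \liminf_{N\to\infty}\frac1N\sum_{i=1}^N(R_i-\bar R)^2>0,$$ where $R_i:=\sum_{j=1}^Na_{ij}$ and $\bar R:=\frac1N\sum_{i=1}^NR_i$. Then the MPL estimator satisfies $$\|(\hat\beta_N-\beta,\hat{\boldsymbol{B}}_N-\boldsymbol{B})\|_2=O_{\mathbb{P}}\left(\frac1{\sqrt N}\right).$$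
   Context: Fix an integer $q\ge2$ and write $[m]=\{1,\dots,m\}$. For each $N$, $\boldsymbol{A}_N=((a_{ij}))_{1\le i,j\le N}$ is a known deterministic symmetric matrix with zero diagonal and non-negative entries. For $\beta>0$ and $\boldsymbol{B}=(B_1,\dots,B_{q-1})\in\mathbb{R}^{q-1}$, with the convention $B_q:=0$, the Potts model is the probability mass function on $[q]^N$ $$\mathbb{P}_{\beta,\boldsymbol{B}}(\boldsymbol{x})=\frac{1}{Z_N(\beta,\boldsymbol{B})}\exp\Big(\frac\beta2\sum_{1\le i,j\le N}a_{ij}\mathbf 1_{x_i=x_j}+\sum_{i=1}^N\sum_{r=1}^qB_r\mathbf 1_{x_i=r}\Big),$$ where $Z_N(\beta,\boldsymbol{B})$ is the normalizing constant. For $\boldsymbol{x}\in[q]^N$ let $m_{i,r}(\boldsymbol{x}):=\sum_{j=1}^Na_{ij}\mathbf 1_{x_j=r}$. The log pseudo-likelihood is, for $(\beta,\boldsymbol{B})\in\mathbb{R}^q$ (with $B_q:=0$), $$\ell_N(\beta,\boldsymbol{B}):=\beta\sum_{i=1}^N\sum_{r=1}^qm_{i,r}(\boldsymbol{X})\mathbf 1_{X_i=r}+\sum_{i=1}^N\sum_{r=1}^qB_r\mathbf 1_{X_i=r}-\sum_{i=1}^N\log\Big(\sum_{r=1}^q\exp\{\beta m_{i,r}(\boldsymbol{X})+B_r\}\Big).$$ The maximum pseudo-likelihood (MPL) estimator $(\hat\beta_N,\hat{\boldsymbol{B}}_N)$ is the unique maximizer of $\ell_N$ over $\mathbb{R}^q$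 when a unique maximizer exists (where it does not exist it may be assigned an arbitrary value). $O_{\mathbb{P}}$ is as $N\to\infty$ under the true law $\mathbb{P}_{\beta,\boldsymbol{B}}$. *)

(* Defs.v *)
From mathcomp Require Import all_boot all_order all_algebra.
From mathcomp Require Import all_classical all_reals all_analysis.

Set Implicit Arguments.
Unset Strict Implicit.
Unset Printing Implicit Defensive.

Import Order.TTheory GRing.Theory Num.Theory.

Local Open Scope classical_set_scope.
Local Open Scope ring_scope.

Section Potts.
Context {R : realType}.

(* Colors and sites are 0-based: the q colors are the elements of 'I_q and the
   N sites those of 'I_N.  A parameter (beta, B) in R^q is a pair
   R * 'rV[R]_q.-1. *)
Definition config (q N : nat) := {ffun 'I_N -> 'I_q}.

Definition param (q : nat) : Type := R * 'rV[R]_q.-1.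

(* B_r for r < q - 1, and 0 for the last color. *)
Definition ext_field (q : nat) (B : 'rV[R]_q.-1) (r : 'I_q) : R :=
  if insub (val r) : option 'I_q.-1 is Some k then B 0 k else 0.

Definition potts_weight (q N : nat) (A : 'M[R]_N) (t : param q)
    (x : config q N) : R :=
  expR (t.1 / 2 * (\sum_(i < N) \sum_(j < N) A i j * (x i == x j)%:R)
        + \sum_(i < N) \sum_(r < q) ext_field t.2 r * (x i == r)%:R).

Definition potts_Z (q N : nat) (A : 'M[R]_N) (t : param q) : R :=
  \sum_(x : config q N) potts_weight A t x.

Definition potts_pmf (q N : nat) (A : 'M[R]_N) (t : param q)
    (x : config q N) : R :=
  potts_weight A t x / potts_Z A t.

Definition local_field (q N : nat) (A : 'M[R]_N) (x : config q N)
    (i : 'I_N) (r : 'I_q) : R :=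
  \sum_(j < N) A i j * (x j == r)%:R.

Definition log_pl (q N : nat) (A : 'M[R]_N) (x : config q N)
    (t : param q) : R :=
  t.1 * (\sum_(i < N) \sum_(r < q) local_field A x i r * (x i == r)%:R)
  + \sum_(i < N) \sum_(r < q) ext_field t.2 r * (x i == r)%:R
  - \sum_(i < N) ln (\sum_(r < q)
      expR (t.1 * local_field A x i r + ext_field t.2 r)).

Definition is_maximizer (T : Type) (f : T -> R) (t : T) : Prop :=
  forall u, f u <= f t.

(* est is unconstrained at the configurations whose log pseudo-likelihood has
   no unique maximizer. *)
Definition is_MPL (q : nat) (A : forall N, 'M[R]_N)
    (est : forall N, config q N -> param q) : Prop :=
  forall N (x : config q N) (t : param q),
    unique (is_maximizer (log_pl (A N) x)) t -> est N x = t.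

(* The canonical norms on pairs and matrices are sup norms, hence this
   Euclidean one. *)
Definition norm2 (q : nat) (t : param q) : R :=
  Num.sqrt (t.1 ^+ 2 + \sum_(k < q.-1) t.2 0 k ^+ 2).

Definition row_sum (N : nat) (A : 'M[R]_N) (i : 'I_N) : R :=
  \sum_(j < N) A i j.

Definition mean_row_sum (N : nat) (A : 'M[R]_N) : R :=
  N%:R^-1 * \sum_(i < N) row_sum A i.

Definition prob (T : finType) (p : T -> R) (E : pred T) : R :=
  \sum_(x | E x) p x.

(* Y_N = O_P(a_N) as N tends to infinity, Y_N being defined on the finite
   probability space T N with probability mass function p N. *)
Definition bigO_prob (T : nat -> finType) (p Y : forall N, T N -> R)
    (a : nat -> R) : Prop :=
  forall e : R, 0 < e -> exists2 M : R, 0 < M &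
    \forall N \near \oo, prob (p N) (fun x => M * a N < `|Y N x|) <= e.

End Potts.

Arguments param R q : clear implicits.

(* Main.v *)
Require Import Defs.
From mathcomp Require Import all_boot all_order all_algebra.
From mathcomp Require Import all_classical all_reals all_analysis.
From mathcomp Require Import ring lra.

Set Implicit Arguments.
Unset Strict Implicit.
Unset Printing Implicit Defensive.

Import Order.TTheory GRing.Theory Num.Theory.
Import numFieldNormedType.Exports.

Local Open Scope classical_set_scope.
Local Open Scope ring_scope.

(** The score of the pseudo-likelihood at the true parameter is a sum of
   residuals f_i - E[f_i | the other spins].  Resampling one spin shows that
   the residuals at i and j have covariance O(a_ij), so that the score, and
   every weighted colour count minus its conditional mean, is O(sqrt N) in L^2.

   Minus the Hessian in the direction (h_1, h) is bounded below by a multiple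
   of sum_{i,r} (h_1 d_{i,r} + h_r)^2, where d_{i,r} = m_{i,r} - m_{i,q}; it is
   of order N as soon as the empirical variance of the d_{i,r} is bounded below.
   If that variance were small, the conditional laws of all the spins would be
   close to one law pi with pi_r / pi_q = exp(beta d_r + B_r), d_r being the
   average of d_{i,r}.  Averaging d_{i,r} against R_i - Rbar then gives
   Var(R) (pi_r - pi_q) ~ 0, so that pi is uniform; averaging it against 1
   gives d_r ~ Rbar (pi_r - pi_q) ~ 0, and hence B_r ~ 0 for every r,
   contradicting B <> 0.

   Since the log pseudo-likelihood is concave, it has its unique maximizer
   within O(1 / sqrt N) of the true parameter. *)

(** * Log-partition functions and softmax laws *)

Section Elementary.
Context {R : realType}.
Implicit Types (x y z L : R).

(** The square of [1 + x / 2 <= expR (x / 2)]; the bound on [x] keeps the left side nonnegative. *)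
Lemma expR_ge_quad x : -2 <= x -> 1 + x + x ^+ 2 / 4 <= expR x.
Proof.
move=> hx; have h1 : 1 + x / 2 <= expR (x / 2) by apply: expR_ge1Dx.
have -> : expR x = expR (x / 2) ^+ 2.
  by rewrite expr2 -expRD; congr expR; field.
have -> : 1 + x + x ^+ 2 / 4 = (1 + x / 2) ^+ 2 by field.
by rewrite ler_sqr ?nnegrE ?expR_ge0 //; lra.
Qed.

Lemma expR_lip x y L : x <= L -> y <= L ->
  `|expR x - expR y| <= expR L * `|x - y|.
Proof.
move=> hx hy; wlog le_yx : x y hx hy / y <= x.
  move=> H; have [/H|/ltW/H] := leP y x; first exact.
  by rewrite distrC (distrC y x); apply.
have le_e : expR y <= expR x by rewrite ler_expR.
rewrite !ger0_norm ?subr_ge0 //.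
have h1 : 1 + (y - x) <= expR (y - x) by apply: expR_ge1Dx.
have hd : expR x * expR (y - x) = expR y by rewrite -expRD; congr expR; ring.
have hL : expR x <= expR L by rewrite ler_expR.
have h0 := expR_gt0 x; nra.
Qed.

(** A converse Lipschitz bound at 0, used to recover the log-ratio of two probabilities from their
    difference. *)
Lemma norm_expR_sub1_ge x L : `|x| <= L -> expR (- L) * `|x| <= `|expR x - 1|.
Proof.
rewrite ler_norml => /andP[lo hi].
have L0 : 0 <= L by lra.
have eL : expR (- L) <= 1 by rewrite -expR0 ler_expR; lra.
have e0 := expR_gt0 (- L).
have [x0|x0] := leP 0 x.
  have h : 1 + x <= expR x by apply: expR_ge1Dx.
  rewrite (ger0_norm x0) ger0_norm; first nra.
  lra.
have h : 1 + (- x) <= expR (- x) by apply: expR_ge1Dx.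
have hx : expR x * expR (- x) = 1 by rewrite -expRD subrr expR0.
have hLx : expR (- L) <= expR x by rewrite ler_expR; lra.
have := expR_gt0 x => ex.
rewrite (ltr0_norm x0) ler0_norm; last by rewrite subr_le0 -expR0 ler_expR ltW.
nra.
Qed.

Lemma cauchy_sum (I : finType) (a b : I -> R) :
  (\sum_i a i * b i) ^+ 2 <= (\sum_i a i ^+ 2) * (\sum_i b i ^+ 2).
Proof.
set A := \sum_i a i ^+ 2; set C := \sum_i b i ^+ 2.
set D := \sum_i a i * b i.
have A0 : 0 <= A by apply: sumr_ge0 => i _; apply: sqr_ge0.
have [Ae|An] := eqVneq A 0.
  have a0 i : a i = 0.
    have /(_ i isT)/eqP := psumr_eq0P (fun i _ => sqr_ge0 (a i)) Ae.
    by rewrite sqrf_eq0 => /eqP.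
  rewrite /D big1; last by move=> i _; rewrite a0 mul0r.
  by rewrite Ae mul0r expr0n.
have h : 0 <= \sum_i (A * b i - D * a i) ^+ 2.
  by apply: sumr_ge0 => i _; apply: sqr_ge0.
have e : \sum_i (A * b i - D * a i) ^+ 2 = A * (A * C - D ^+ 2).
  transitivity (\sum_i (A ^+ 2 * (b i ^+ 2) + D ^+ 2 * a i ^+ 2
                        - 2 * A * D * (a i * b i))).
    by apply: eq_bigr => i _; ring.
  rewrite sumrB big_split /= -!mulr_sumr -/A -/C -/D; ring.
have Ap : 0 < A by rewrite lt_def An.
by move: h; rewrite e pmulr_rge0 // subr_ge0.
Qed.

Lemma norm_inv_sub_le x y : 1 <= x -> 1 <= y -> `|x^-1 - y^-1| <= `|x - y|.
Proof.
move=> hx hy; have xn : x != 0 by lra.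
have yn : y != 0 by lra.
have -> : x^-1 - y^-1 = (y - x) / (x * y) by field; rewrite xn yn.
rewrite normrM distrC ler_piMr // normfV ger0_norm; last by nra.
by rewrite invf_le1; nra.
Qed.

End Elementary.

Section Softmax.
Context {R : realType} {I : finType}.
Implicit Types (a v w : I -> R) (r s : I) (L c : R).

Definition partition_fun a : R := \sum_r expR (a r).
Definition softmax a r : R := expR (a r) / partition_fun a.
Definition softmax_mean a v : R := \sum_r softmax a r * v r.

Lemma partition_fun_gt0 a r : 0 < partition_fun a.
Proof.
rewrite /partition_fun (bigD1 r) //= ltr_pwDl ?expR_gt0 //.
by apply: sumr_ge0 => s _; apply: expR_ge0.
Qed.

Lemma softmax_gt0 a r : 0 < softmax a r.
Proof. by rewrite divr_gt0 ?expR_gt0 // (partition_fun_gt0 _ r). Qed.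

Lemma softmax_sum1 a r : \sum_s softmax a s = 1.
Proof. by rewrite -mulr_suml divff // gt_eqF // (partition_fun_gt0 _ r). Qed.

Lemma softmaxV a r : (softmax a r)^-1 = \sum_s expR (a s - a r).
Proof.
rewrite /softmax invf_div mulr_suml; apply: eq_bigr => s _.
by rewrite expRB.
Qed.

Lemma softmaxE a r : softmax a r = (\sum_s expR (a s - a r))^-1.
Proof. by apply: invr_inj; rewrite softmaxV invrK. Qed.

Lemma softmax_shift a c : softmax (fun r => a r + c) = softmax a.
Proof.
apply/funext => r; rewrite !softmaxE; congr (_^-1).
by apply: eq_bigr => s _; congr expR; ring.
Qed.

Lemma softmax_ge a r L : (forall s, a s - a r <= L) ->
  expR (- L) / #|I|%:R <= softmax a r.
Proof.
move=> h.
have I0 : 0 < #|I|%:R :> R by rewrite ltr0n; apply/card_gt0P; exists r.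
rewrite -[leLHS]invrK invf_div expRN invrK softmaxE lef_pV2 ?posrE.
- rewrite mulrC mulr_natr -sumr_const; apply: ler_sum => s _.
  by rewrite ler_expR.
- by rewrite mulr_gt0 ?expR_gt0.
- by rewrite -(softmaxV a r) invr_gt0 softmax_gt0.
Qed.

(** By [softmaxE] both probabilities are inverses of sums that are at least 1 because of the term
    [s = r], and inversion is 1-Lipschitz there. *)
Lemma softmax_lip a b r L :
    (forall s, a s - a r <= L) -> (forall s, b s - b r <= L) ->
  `|softmax a r - softmax b r| <=
    expR L * \sum_s (`|a s - b s| + `|a r - b r|).
Proof.
move=> ha hb; have ge1 (f : I -> R) : 1 <= \sum_s expR (f s - f r).
  rewrite (bigD1 r) //= subrr expR0 lerDl.
  by apply: sumr_ge0 => s _; apply: expR_ge0.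
rewrite !softmaxE; apply: le_trans (norm_inv_sub_le (ge1 a) (ge1 b)) _.
rewrite -sumrB mulr_sumr; apply: le_trans (ler_norm_sum _ _ _) _.
apply: ler_sum => s _; apply: le_trans (expR_lip (ha s) (hb s)) _.
rewrite ler_pM2l ?expR_gt0 //.
have -> : a s - a r - (b s - b r) = (a s - b s) - (a r - b r) by ring.
exact: ler_normB.
Qed.

Lemma softmax_expR_gt0 a v r : 0 < \sum_s softmax a s * expR (v s).
Proof.
rewrite (bigD1 r) //= ltr_pwDl //.
  by rewrite mulr_gt0 ?expR_gt0 ?softmax_gt0.
by apply: sumr_ge0 => s _; rewrite mulr_ge0 ?expR_ge0 // ltW ?softmax_gt0.
Qed.

Lemma ln_partition_funD a v r :
  ln (partition_fun (fun s => a s + v s)) =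
  ln (partition_fun a) + ln (\sum_s softmax a s * expR (v s)).
Proof.
have Z0 := partition_fun_gt0 a r.
rewrite -lnM ?posrE //.
  congr ln; rewrite mulr_sumr; apply: eq_bigr => s _.
  by rewrite mulrA [partition_fun a * _]mulrC divfK ?gt_eqF // expRD.
exact: softmax_expR_gt0.
Qed.

(** Isolates the gap between log-sum-exp and its tangent as the log-moment generating function of
    the centred [v]; lower bounds on it give convexity in its plain, strict and quadratic forms. *)
Lemma ln_partition_fun_centered a v r :
  ln (partition_fun (fun s => a s + v s)) =
  ln (partition_fun a) + softmax_mean a v +
  ln (\sum_s softmax a s * expR (v s - softmax_mean a v)).
Proof.
set mu := softmax_mean a v.
rewrite (ln_partition_funD a v r) -addrA; congr (_ + _).
rewrite -{1}[mu]expRK -lnM ?posrE ?expR_gt0 //.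
  congr ln; rewrite mulr_sumr; apply: eq_bigr => s _.
  by rewrite mulrCA -expRD; congr (_ * expR _); ring.
exact: softmax_expR_gt0.
Qed.

Lemma softmax_mean_centered a v r :
  \sum_s softmax a s * (v s - softmax_mean a v) = 0.
Proof.
under eq_bigr do rewrite mulrBr.
by rewrite sumrB -mulr_suml (softmax_sum1 _ r) mul1r subrr.
Qed.

Lemma ln_partition_fun_tangent a v r :
  ln (partition_fun a) + softmax_mean a v <=
  ln (partition_fun (fun s => a s + v s)).
Proof.
rewrite (ln_partition_fun_centered a v r) lerDl ln_ge0 //.
apply: (@le_trans _ _ (\sum_s softmax a s * (1 + (v s - softmax_mean a v)))).
  under eq_bigr do rewrite mulrDr mulr1.
  rewrite big_split /= (softmax_sum1 _ r).
  by rewrite (softmax_mean_centered _ _ r) addr0.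
by apply: ler_sum => s _; rewrite ler_pM2l ?softmax_gt0 ?expR_ge1Dx.
Qed.

Lemma ln_partition_fun_tangent_lt a v r s : v r != v s ->
  ln (partition_fun a) + softmax_mean a v <
  ln (partition_fun (fun s => a s + v s)).
Proof.
move=> vrs; rewrite (ln_partition_fun_centered a v r) ltrDl ln_gt0 //.
have [u hu] : exists u, v u - softmax_mean a v != 0.
  have [/eqP h|h] := eqVneq (v r - softmax_mean a v) 0; last by exists r.
  exists s; rewrite subr_eq0 in h; rewrite subr_eq0 -(eqP h).
  by rewrite eq_sym.
apply: (@le_lt_trans _ _
    (\sum_s softmax a s * (1 + (v s - softmax_mean a v)))).
  under eq_bigr do rewrite mulrDr mulr1.
  rewrite big_split /= (softmax_sum1 _ r).
  by rewrite (softmax_mean_centered _ _ r) addr0.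
rewrite (bigD1 u) //= [ltRHS](bigD1 u) //= ltr_leD //.
  by rewrite ltr_pM2l ?softmax_gt0 ?expR_gt1Dx.
by apply: ler_sum => t _; rewrite ler_pM2l ?softmax_gt0 ?expR_ge1Dx.
Qed.

Lemma softmax_mean_norm_le a v r c : (forall s, `|v s| <= c) ->
  `|softmax_mean a v| <= c.
Proof.
move=> hv; apply: le_trans (ler_norm_sum _ _ _) _.
rewrite -[leRHS]mul1r -(softmax_sum1 a r) mulr_suml; apply: ler_sum => s _.
by rewrite normrM gtr0_norm ?softmax_gt0 // ler_pM2l ?softmax_gt0.
Qed.

(** With [Q] the variance of [v] under the softmax law, [expR_ge_quad] gives [1 + Q / 4 <= S], then
    [Q / 8 <= ln S]; the constant 16 is this 8 times the 2 lost in comparing [Q] with the squared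
    differences. *)
Lemma ln_partition_fun_quad a v r c : 0 <= c ->
    (forall s, c <= softmax a s) -> (forall s, `|v s| <= 1) ->
  ln (partition_fun a) + softmax_mean a v +
    c / (16 * #|I|%:R) * \sum_s (v s - v r) ^+ 2 <=
  ln (partition_fun (fun s => a s + v s)).
Proof.
move=> c0 hc hv; rewrite (ln_partition_fun_centered a v r) lerD2l.
set mu := softmax_mean a v; set S := \sum_s _ * expR _.
have mu1 : `|mu| <= 1 by apply: (softmax_mean_norm_le a r).
set Q := \sum_s softmax a s * (v s - mu) ^+ 2.
have w2 s : `|v s - mu| <= 2.
  by apply: le_trans (ler_normB _ _) _; have := hv s; lra.
have Q0 : 0 <= Q.
  by apply: sumr_ge0 => s _; rewrite mulr_ge0 ?sqr_ge0 // ltW ?softmax_gt0.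
have Q4 : Q <= 4.
  rewrite -[leRHS]mul1r -[X in X * 4](softmax_sum1 a r) mulr_suml.
  apply: ler_sum => s _.
  rewrite ler_pM2l ?softmax_gt0 //.
  move: (w2 s); rewrite ler_norml => /andP[lo hi].
  have : 0 <= (2 - (v s - mu)) * (2 + (v s - mu)) by apply: mulr_ge0; lra.
  by move: (v s - mu) => w hw; nra.
have QS : 1 + Q / 4 <= S.
  have -> : 1 + Q / 4 =
      \sum_s softmax a s * (1 + (v s - mu) + (v s - mu) ^+ 2 / 4).
    under eq_bigr do rewrite mulrDr [_ * (1 + _)]mulrDr mulr1 mulrA.
    rewrite !big_split /= (softmax_sum1 _ r).
    rewrite (softmax_mean_centered a v r : _ = 0) addr0.
    by rewrite -mulr_suml.
  apply: ler_sum => s _; rewrite ler_pM2l ?softmax_gt0 //.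
  by apply: expR_ge_quad; move: (w2 s); rewrite ler_norml => /andP[].
have I0 : 0 < #|I|%:R :> R by rewrite ltr0n; apply/card_gt0P; exists r.
have QV : c / (2 * #|I|%:R) * \sum_s (v s - v r) ^+ 2 <= Q.
  (* Only the terms [s] and [r] of [Q] are kept, each of weight at least [c]; summing over [s] costs
     the factor [#|I|]. *)
  have h s : c / 2 * (v s - v r) ^+ 2 <= Q.
    have [->|sr] := eqVneq s r; first by rewrite subrr expr0n mulr0.
    rewrite /Q (bigD1 s) //= (bigD1 r) /=; last by rewrite eq_sym.
    rewrite addrA; apply: (@le_trans _ _
        (softmax a s * (v s - mu) ^+ 2 + softmax a r * (v r - mu) ^+ 2)).
      have -> : v s - v r = (v s - mu) - (v r - mu) by ring.
      move: (hc s) (hc r) (v s - mu) (v r - mu) => hs hr x y.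
      have := sqr_ge0 (x + y); have := sqr_ge0 x; have := sqr_ge0 y.
      nra.
    rewrite lerDl; apply: sumr_ge0 => t _.
    by rewrite mulr_ge0 ?sqr_ge0 // ltW ?softmax_gt0.
  have : \sum_s c / 2 * (v s - v r) ^+ 2 <= \sum_(s : I) Q.
    by apply: ler_sum => s _; apply: h.
  rewrite -mulr_sumr sumr_const -[Q *+ _]mulr_natr -ler_pdivrMr //.
  by apply: le_trans; rewrite le_eqVlt; apply/orP; left; apply/eqP; field; lra.
have lnS : Q / 8 <= ln S.
  apply: (@le_trans _ _ (ln (1 + Q / 4))); last first.
    by rewrite ler_ln ?posrE //; lra.
  have q1 : 0 < 1 + Q / 4 by lra.
  rewrite -[ln _]opprK -lnV ?posrE // -[leLHS]opprK lerN2.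
  (* A lower bound on [ln (1 + Q / 4)] comes from the upper bound on the logarithm of its inverse;
     [Q <= 4] makes that inverse at most [1 - Q / 8]. *)
  have := @le_ln1Dx R ((1 + Q / 4)^-1 - 1).
  have -> : 1 + ((1 + Q / 4)^-1 - 1) = (1 + Q / 4)^-1 by ring.
  move=> /(_ _)/le_trans; apply.
    by have := q1; rewrite -invr_gt0; lra.
  have : (1 + Q / 4)^-1 <= 1 - Q / 8; last lra.
  by rewrite -[leLHS]div1r ler_pdivrMr //; nra.
apply: le_trans lnS; rewrite ler_pdivlMr //; apply: le_trans QV.
by rewrite le_eqVlt; apply/orP; left; apply/eqP; field; lra.
Qed.

End Softmax.

(** * Resampling one spin *)

Section Glauber.
Context {R : realType} {q N : nat}.
Implicit Types (A : 'M[R]_N) (t : param R q) (x : config q N) (i j : 'I_N).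
Implicit Types (r s : 'I_q) (f : 'I_N -> config q N -> 'I_q -> R).

Definition recolor x i r : config q N := [ffun j => if j == i then r else x j].

Definition local_energy A t x i r : R :=
  t.1 * local_field A x i r + ext_field t.2 r.

(** The conditional law of the spin at [i] given the others; when [A i i = 0] it does not depend on
    [x i]. *)
Definition cond_law A t x i : 'I_q -> R := softmax (local_energy A t x i).

Definition potts_mean A t (g : config q N -> R) : R :=
  \sum_x potts_pmf A t x * g x.

Definition residual_at A t f i x : R :=
  f i x (x i) - \sum_r cond_law A t x i r * f i x r.

Definition residual A t f x : R := \sum_i residual_at A t f i x.

Lemma recolor_eq x i r : recolor x i r i = r.
Proof. by rewrite ffunE eqxx. Qed.

Lemma recolor_neq x i j r : j != i -> recolor x i r j = x j.
Proof. by move=> ji; rewrite ffunE (negbTE ji). Qed.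

Lemma recolor_id x i : recolor x i (x i) = x.
Proof. by apply/ffunP => j; rewrite ffunE; case: eqP => [->|]. Qed.

Lemma recolor_recolor x i r s : recolor (recolor x i r) i s = recolor x i s.
Proof. by apply/ffunP => j; rewrite !ffunE; case: eqP. Qed.

Lemma sum_color_indicator (b : 'I_q -> R) s : \sum_r b r * (s == r)%:R = b s.
Proof.
rewrite (bigD1 s) //= eqxx mulr1 big1 ?addr0 // => r rs.
by rewrite eq_sym (negbTE rs) mulr0.
Qed.

Lemma local_field_recolor A x i j r s :
  local_field A (recolor x i s) j r - local_field A x j r =
  A j i * ((s == r)%:R - (x i == r)%:R).
Proof.
rewrite /local_field (bigD1 i) //= [X in _ - X](bigD1 i) //= recolor_eq.
rewrite (eq_bigr (fun k => A j k * (x k == r)%:R)); first by ring.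
by move=> k ki; rewrite recolor_neq.
Qed.

Lemma local_field_recolor_diag A x i r s : A i i = 0 ->
  local_field A (recolor x i s) i r = local_field A x i r.
Proof.
by move=> a0; apply/eqP; rewrite -subr_eq0 local_field_recolor a0 mul0r.
Qed.

Lemma local_energy_recolor_diag A t x i s : A i i = 0 ->
  local_energy A t (recolor x i s) i = local_energy A t x i.
Proof.
by move=> a0; apply/funext => r; rewrite /local_energy local_field_recolor_diag.
Qed.

Lemma cond_law_recolor_diag A t x i s : A i i = 0 ->
  cond_law A t (recolor x i s) i = cond_law A t x i.
Proof. by move=> a0; rewrite /cond_law local_energy_recolor_diag. Qed.

(** By symmetry row [i] and column [i] contribute equally; the factor 2 cancels the 1/2 in
    [potts_weight]. *)
Lemma pair_energy_split A x i : A^T = A -> A i i = 0 ->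
  \sum_k \sum_j A k j * (x k == x j)%:R =
  2 * local_field A x i (x i) +
  \sum_(k | k != i) \sum_(j | j != i) A k j * (x k == x j)%:R.
Proof.
move=> Asym a0; rewrite (bigD1 i) //=.
have -> : \sum_j A i j * (x i == x j)%:R = local_field A x i (x i).
  by apply: eq_bigr => j _; rewrite eq_sym.
have -> : \sum_(k | k != i) \sum_j A k j * (x k == x j)%:R =
    local_field A x i (x i) +
    \sum_(k | k != i) \sum_(j | j != i) A k j * (x k == x j)%:R.
  rewrite /local_field [X in _ = X + _](bigD1 i) //= a0 mul0r add0r -big_split.
  apply: eq_bigr => k ki /=; rewrite (bigD1 i) //=; congr (_ * _ + _).
  by rewrite -{1}Asym mxE.
ring.
Qed.

Lemma potts_weight_split A t x i : A^T = A -> A i i = 0 ->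
  potts_weight A t x = expR (local_energy A t x i (x i)) *
  expR (t.1 / 2 * (\sum_(k | k != i) \sum_(j | j != i) A k j * (x k == x j)%:R)
        + \sum_(k | k != i) ext_field t.2 (x k)).
Proof.
move=> Asym a0; rewrite /potts_weight (pair_energy_split x Asym a0) -expRD.
have -> : \sum_k \sum_r ext_field t.2 r * (x k == r)%:R =
    ext_field t.2 (x i) + \sum_(k | k != i) ext_field t.2 (x k).
  under eq_bigr do rewrite sum_color_indicator.
  by rewrite (bigD1 i).
by rewrite /local_energy; congr expR; field.
Qed.

Lemma potts_weight_recolor A t x i r : A^T = A -> A i i = 0 ->
  potts_weight A t (recolor x i r) * expR (local_energy A t x i (x i)) =
  potts_weight A t x * expR (local_energy A t x i r).
Proof.
move=> Asym a0; rewrite !(potts_weight_split _ _ Asym a0) recolor_eq.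
rewrite local_energy_recolor_diag //.
have -> : \sum_(k | k != i) ext_field t.2 (recolor x i r k) =
    \sum_(k | k != i) ext_field t.2 (x k).
  by apply: eq_bigr => k ki; rewrite recolor_neq.
have -> : \sum_(k | k != i) \sum_(j | j != i)
      A k j * (recolor x i r k == recolor x i r j)%:R =
    \sum_(k | k != i) \sum_(j | j != i) A k j * (x k == x j)%:R.
  by apply: eq_bigr => k ki; apply: eq_bigr => j ji; rewrite !recolor_neq.
ring.
Qed.

Lemma potts_detailed_balance A t x i r : A^T = A -> A i i = 0 ->
  potts_pmf A t x * cond_law A t x i r =
  potts_pmf A t (recolor x i r) * cond_law A t x i (x i).
Proof.
move=> Asym a0; rewrite /potts_pmf /cond_law /softmax.
by rewrite mulrACA -potts_weight_recolor // mulrACA.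
Qed.

(** Invariance of the Gibbs measure under heat-bath resampling of one site. *)
Lemma potts_mean_resample A t (g : config q N -> R) i :
    A^T = A -> A i i = 0 ->
  potts_mean A t g =
  potts_mean A t (fun x => \sum_r cond_law A t x i r * g (recolor x i r)).
Proof.
move=> Asym a0; rewrite /potts_mean.
(* Exchanging the old and the proposed color is an involution, and detailed balance says that it
   preserves the joint weight. *)
pose h (u : config q N * 'I_q) := (recolor u.1 i u.2, u.1 i).
have hK : involutive h.
  by move=> [x r]; rewrite /h /= recolor_recolor recolor_id recolor_eq.
transitivity (\sum_(u : config q N * 'I_q)
    potts_pmf A t u.1 * (cond_law A t u.1 i u.2 * g u.1)).
  rewrite -(pair_bigA _ (fun x r =>
    potts_pmf A t x * (cond_law A t x i r * g x))) /=.
  apply: eq_bigr => x _; rewrite -mulr_sumr -mulr_suml.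
  by rewrite (softmax_sum1 _ (x i)) mul1r.
rewrite (reindex_inj (inv_inj hK)) /=.
rewrite -(pair_bigA _ (fun x r => potts_pmf A t (recolor x i r) *
  (cond_law A t (recolor x i r) i (x i) * g (recolor x i r)))) /=.
apply: eq_bigr => x _; rewrite mulr_sumr; apply: eq_bigr => r _.
by rewrite cond_law_recolor_diag // mulrA -potts_detailed_balance // -mulrA.
Qed.

(** Given the spins off [i], the factor [g] is constant and the residual has mean zero; resampling
    at [i] makes this conditioning explicit. *)
Lemma potts_mean_residual_mul A t f i (g : config q N -> R) :
    A^T = A -> A i i = 0 ->
    (forall x s r, f i (recolor x i s) r = f i x r) ->
    (forall x s, g (recolor x i s) = g x) ->
  potts_mean A t (fun x => residual_at A t f i x * g x) = 0.
Proof.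
move=> Asym a0 fi gi; rewrite (potts_mean_resample _ _ Asym a0).
rewrite /potts_mean big1 // => x _.
apply/eqP; rewrite mulf_eq0; apply/orP; right; rewrite /residual_at; apply/eqP.
under eq_bigr => r _.
  rewrite gi recolor_eq fi cond_law_recolor_diag //.
  under [X in _ - X]eq_bigr do rewrite fi.
  rewrite mulrA; over.
by rewrite -mulr_suml (softmax_mean_centered _ (f i x) (x i)) mul0r.
Qed.

Lemma potts_weight_gt0 A t x : 0 < potts_weight A t x.
Proof. exact: expR_gt0. Qed.

Lemma potts_Z_gt0 A t x : 0 < potts_Z A t.
Proof.
rewrite /potts_Z (bigD1 x) //= ltr_pwDl ?potts_weight_gt0 //.
by apply: sumr_ge0 => y _; rewrite ltW ?potts_weight_gt0.
Qed.

Lemma potts_pmf_ge0 A t x : 0 <= potts_pmf A t x.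
Proof. by rewrite ltW // divr_gt0 ?potts_weight_gt0 // (potts_Z_gt0 _ _ x). Qed.

Lemma potts_mean_le A t (g h : config q N -> R) :
  (forall x, g x <= h x) -> potts_mean A t g <= potts_mean A t h.
Proof.
by move=> gh; apply: ler_sum => x _; rewrite ler_wpM2l ?potts_pmf_ge0.
Qed.

Lemma potts_mean_cst A t (x : config q N) c : potts_mean A t (fun=> c) = c.
Proof.
rewrite /potts_mean /potts_pmf -mulr_suml -mulr_suml divff ?mul1r //.
by rewrite gt_eqF // (potts_Z_gt0 _ _ x).
Qed.

Lemma potts_markov A t (g : config q N -> R) c : 0 < c ->
    (forall x, 0 <= g x) ->
  prob (fun x => potts_pmf A t x) (fun x => c < g x) <= potts_mean A t g / c.
Proof.
move=> c0 g0; rewrite ler_pdivlMr // /prob mulr_suml big_mkcond /=.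
apply: ler_sum => x _; case: ifP => [cg|_].
  by rewrite ler_wpM2l ?potts_pmf_ge0 // ltW.
by rewrite mulr_ge0 ?potts_pmf_ge0.
Qed.

End Glauber.

(** * Second moment of the residuals *)

Section SecondMoment.
Context {R : realType} {q N : nat}.
Context (A : 'M[R]_N) (gamma : R).
Context (Asym : A^T = A) (Adiag : forall i, A i i = 0).
Context (Age0 : forall i j, 0 <= A i j).
Context (Abound : forall i, row_sum A i <= gamma).
Implicit Types (t : param R q) (x : config q N) (i j : 'I_N) (r s : 'I_q).

Lemma local_field_ge0 x i r : 0 <= local_field A x i r.
Proof. by apply: sumr_ge0 => j _; rewrite mulr_ge0. Qed.

Lemma local_field_le x i r : local_field A x i r <= gamma.
Proof.
apply: le_trans (Abound i); apply: ler_sum => j _.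
by rewrite ler_piMr // lern1 leq_b1.
Qed.

Lemma row_sum_ge0 i : 0 <= row_sum A i.
Proof. by apply: sumr_ge0. Qed.

Lemma local_field_recolor_lip x i j r s :
  `|local_field A (recolor x i s) j r - local_field A x j r| <= A i j.
Proof.
rewrite local_field_recolor normrM ger0_norm // -{2}Asym mxE ler_piMr //.
by case: (_ == _); case: (_ == _) => /=; rewrite ?subr0 ?subrr ?sub0r ?normrN
  ?normr0 ?normr1.
Qed.

Lemma local_energy_recolor_lip t x i j r s :
  `|local_energy A t (recolor x i s) j r - local_energy A t x j r|
    <= `|t.1| * A i j.
Proof.
rewrite /local_energy opprD addrACA subrr addr0 -mulrBr normrM.
by rewrite ler_wpM2l // local_field_recolor_lip.
Qed.

(** Bounds the differences of local energies between colors when row sums are at most [g]; it is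
    free of [N] and of the configuration. *)
Definition energy_spread (g : R) t : R :=
  `|t.1| * g + 2 * \sum_r `|ext_field t.2 r|.

Lemma ext_field_norm_le t r : `|ext_field t.2 r| <= \sum_s `|ext_field t.2 s|.
Proof. by rewrite (bigD1 r) //= lerDl sumr_ge0. Qed.

Lemma local_energy_spread t x i r s :
  local_energy A t x i s - local_energy A t x i r <= energy_spread gamma t.
Proof.
have hs := ext_field_norm_le t s; have hr := ext_field_norm_le t r.
have h : t.1 * (local_field A x i s - local_field A x i r) <= `|t.1| * gamma.
  apply: le_trans (ler_norm _) _; rewrite normrM ler_wpM2l // ler_norml.
  have := local_field_ge0 x i s; have := local_field_ge0 x i r.
  have := local_field_le x i s; have := local_field_le x i r.
  by move=> *; apply/andP; split; lra.
have := ler_norm (ext_field t.2 s); have := ler_norm (- ext_field t.2 r).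
rewrite normrN /local_energy /energy_spread mulrBr in h *; lra.
Qed.

Lemma cond_law_recolor_lip t x i j r s :
  `|cond_law A t (recolor x i s) j r - cond_law A t x j r| <=
  expR (energy_spread gamma t) * (q%:R * (2 * `|t.1|)) * A i j.
Proof.
apply: le_trans (softmax_lip (L := energy_spread gamma t) _ _) _.
- by move=> u; apply: local_energy_spread.
- by move=> u; apply: local_energy_spread.
rewrite -!mulrA ler_pM2l ?expR_gt0 //.
apply: (@le_trans _ _ (\sum_(u < q) (2 * (`|t.1| * A i j)))); last first.
  by rewrite sumr_const card_ord -[_ *+ q]mulr_natl.
apply: ler_sum => u _.
have := local_energy_recolor_lip t x i j u s.
by have := local_energy_recolor_lip t x i j r s; lra.
Qed.

(** For [i = j] and a zero diagonal, the second condition says that [f i] ignores the spin at [i],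
    so that [residual_at] subtracts a true conditional expectation. *)
Definition lipschitz_family (K L : R) (f : 'I_N -> config q N -> 'I_q -> R) :=
  (forall i x r, `|f i x r| <= K) /\
  (forall i j x s r, `|f j (recolor x i s) r - f j x r| <= L * A i j).

Definition residual_lip t (K L : R) : R :=
  2 * L + q%:R * (expR (energy_spread gamma t) * (q%:R * (2 * `|t.1|)) * K).

Context (t : param R q) (K L : R) (f : 'I_N -> config q N -> 'I_q -> R).
Context (fK : lipschitz_family K L f).

Lemma residual_at_norm_le i x : `|residual_at A t f i x| <= 2 * K.
Proof.
apply: le_trans (ler_normB _ _) _.
have := softmax_mean_norm_le (local_energy A t x i) (x i) (fK.1 i x).
by rewrite /softmax_mean /cond_law; have := fK.1 i x (x i); lra.
Qed.

Lemma residual_at_recolor_lip i j x s : j != i ->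
  `|residual_at A t f j (recolor x i s) - residual_at A t f j x| <=
  residual_lip t K L * A i j.
Proof.
move=> ji; rewrite /residual_at recolor_neq //.
set x' := recolor x i s.
(* Three sources of change: [f] at the actual color, [f] averaged under the new law, and the law
   itself. The first two give [2 * L], the third the rest of [residual_lip]. *)
have -> : f j x' (x j) - \sum_r cond_law A t x' j r * f j x' r -
    (f j x (x j) - \sum_r cond_law A t x j r * f j x r) =
    (f j x' (x j) - f j x (x j)) -
    (\sum_r cond_law A t x' j r * (f j x' r - f j x r)) -
    \sum_r (cond_law A t x' j r - cond_law A t x j r) * f j x r.
  under [X in _ = _ - X - _]eq_bigr do rewrite mulrBr.
  under [X in _ = _ - X]eq_bigr do rewrite mulrBl.
  rewrite !sumrB; ring.
apply: le_trans (ler_normB _ _) _.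
apply: le_trans (lerD (ler_normB _ _) (lexx _)) _.
have h1 := fK.2 i j x s (x j).
have h2 := softmax_mean_norm_le (local_energy A t x' j) (x j)
  (fun r => fK.2 i j x s r).
have h3 : `|\sum_r (cond_law A t x' j r - cond_law A t x j r) * f j x r| <=
    q%:R * (expR (energy_spread gamma t) * (q%:R * (2 * `|t.1|)) * K) * A i j.
  apply: le_trans (ler_norm_sum _ _ _) _.
  rewrite -[leRHS]mulrA mulr_natl -[X in _ *+ X](card_ord q) -sumr_const.
  apply: ler_sum => r _; rewrite normrM mulrAC.
  by apply: ler_pM => //; [apply: cond_law_recolor_lip|apply: fK.1].
rewrite /softmax_mean in h2; rewrite /residual_lip mulrDl.
apply: lerD h3; rewrite -mulrA mulr_natl mulr2n; exact: lerD h1 h2.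
Qed.

(** With the spin at [i] frozen to [r0] inside the residual at [j], the product has mean zero; the
    price of freezing is the Lipschitz bound of that residual. *)
Lemma residual_cross_mean (r0 : 'I_q) i j : j != i ->
  potts_mean A t (fun x => residual_at A t f i x * residual_at A t f j x) <=
  2 * K * residual_lip t K L * A i j.
Proof.
move=> ji.
have f0 x s r : f i (recolor x i s) r = f i x r.
  apply/eqP; rewrite -subr_eq0 -normr_le0.
  by have := fK.2 i i x s r; rewrite Adiag mulr0.
have := potts_mean_residual_mul t Asym (Adiag i) f0
  (fun x s => congr1 _ (recolor_recolor x i s r0)) (g := fun x =>
    residual_at A t f j (recolor x i r0)) => e.
rewrite -[leLHS]subr0 -[X in _ - X]e /potts_mean -sumrB.
apply: (@le_trans _ _ (potts_mean A t
  (fun=> 2 * K * residual_lip t K L * A i j))); last first.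
  by rewrite (potts_mean_cst A t [ffun=> r0]).
apply: ler_sum => x _; rewrite -mulrBr -mulrBr ler_wpM2l ?potts_pmf_ge0 //.
apply: le_trans (ler_norm _) _; rewrite normrM -[leRHS]mulrA.
apply: ler_pM => //; first exact: residual_at_norm_le.
by rewrite distrC; apply: residual_at_recolor_lip.
Qed.

(* For j != i the residual at i has conditional mean zero given the other
   spins, and the residual at j depends on the spin at i only through A i j. *)
Lemma residual_second_moment (r0 : 'I_q) : 0 <= K -> 0 <= L ->
  potts_mean A t (fun x => residual A t f x ^+ 2) <=
  (4 * K ^+ 2 + 2 * K * residual_lip t K L * gamma) * N%:R.
Proof.
move=> K0 L0.
have C0 : 0 <= residual_lip t K L.
  rewrite /residual_lip addr_ge0 ?mulr_ge0 // ?expR_ge0 //.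
have -> : potts_mean A t (fun x => residual A t f x ^+ 2) =
    \sum_i \sum_j
      potts_mean A t (fun x => residual_at A t f i x * residual_at A t f j x).
  rewrite /potts_mean; under [RHS]eq_bigr do rewrite exchange_big /=.
  rewrite [RHS]exchange_big /=; apply: eq_bigr => x _.
  under eq_bigr do rewrite -mulr_sumr -mulr_sumr.
  by rewrite -mulr_sumr -mulr_suml expr2.
rewrite mulr_natr -[X in _ *+ X](card_ord N) -sumr_const.
apply: ler_sum => i _.
apply: (@le_trans _ _ (\sum_j ((j == i)%:R * (4 * K ^+ 2) +
    2 * K * residual_lip t K L * A i j))).
  apply: ler_sum => j _; have [->|ji] := eqVneq j i.
    rewrite Adiag mulr0 addr0 mul1r -(potts_mean_cst A t [ffun=> r0] (4 * _)).
    apply: potts_mean_le => x; rewrite -expr2 -real_normK ?num_real //.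
    have := residual_at_norm_le i x; have := normr_ge0 (residual_at A t f i x).
    by move: `|_| => y; nra.
  by rewrite mul0r add0r; apply: residual_cross_mean.
rewrite big_split /= -mulr_suml -mulr_sumr.
rewrite (bigD1 i) //= eqxx big1 ?addr0 ?mul1r; last by move=> j /negbTE ->.
by rewrite lerD2l ler_wpM2l ?Abound // mulr_ge0 // mulr_ge0.
Qed.

End SecondMoment.

(** * Gaps between the local fields of two colours *)

Section Average.
Context {R : realType} {N : nat}.
Implicit Types (g h : 'I_N -> R) (c : R).

Definition average g : R := N%:R^-1 * \sum_i g i.

Lemma averageD g h : average (fun i => g i + h i) = average g + average h.
Proof. by rewrite /average big_split mulrDr. Qed.

Lemma averageB g h : average (fun i => g i - h i) = average g - average h.
Proof. by rewrite /average sumrB mulrBr. Qed.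

Lemma averageZ c g : average (fun i => c * g i) = c * average g.
Proof. by rewrite /average -mulr_sumr mulrCA. Qed.

Lemma average_le g h : (forall i, g i <= h i) -> average g <= average h.
Proof. by move=> gh; rewrite ler_wpM2l ?invr_ge0 // ler_sum. Qed.

Lemma average_norm g : `|average g| <= average (fun i => `|g i|).
Proof.
rewrite /average normrM ger0_norm ?invr_ge0 //.
by rewrite ler_wpM2l ?invr_ge0 // ler_norm_sum.
Qed.

Lemma average_sum (I : finType) (g : I -> 'I_N -> R) :
  average (fun i => \sum_s g s i) = \sum_s average (g s).
Proof. by rewrite /average exchange_big mulr_sumr. Qed.

Context (N0 : (0 < N)%N).

Lemma average_cst c : average (fun=> c) = c.
Proof.
have Nn : N%:R != 0 :> R by rewrite pnatr_eq0 -lt0n.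
by rewrite /average sumr_const card_ord -[c *+ N]mulr_natl mulKf.
Qed.

Lemma average_norm_le g c : (forall i, `|g i| <= c) -> `|average g| <= c.
Proof.
move=> gc; apply: le_trans (average_norm g) _.
by rewrite -[leRHS]average_cst average_le.
Qed.

Lemma average_centered g : average (fun i => g i - average g) = 0.
Proof. by rewrite averageB average_cst subrr. Qed.

End Average.

Section ColorGaps.
Context {R : realType} {q N : nat}.
Context (A : 'M[R]_N) (gamma : R).
Context (Asym : A^T = A) (Age0 : forall i j, 0 <= A i j).
Context (Abound : forall i, row_sum A i <= gamma) (N0 : (0 < N)%N).
Implicit Types (i j : 'I_N) (r s : 'I_q.+1).
Context (t : param R q.+1) (x : config q.+1 N).

(** Softmax laws see only energy differences; the last color is the reference because its field is
    0. *)
Definition color_gap i r : R := local_field A x i r - local_field A x i ord_max.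

Definition mean_gap r : R := average (fun i => color_gap i r).

Definition gap_variance : R :=
  average (fun i => \sum_r (color_gap i r - mean_gap r) ^+ 2).

(** Test function whose residual is the [w]-weighted count of color [s] minus its conditional
    mean. *)
Definition color_weight (w : 'I_N -> R) s :
    'I_N -> config q.+1 N -> 'I_q.+1 -> R :=
  fun i _ r => w i * (r == s)%:R.

(** The law [pi] to which the conditional laws are close on average when [gap_variance] is small. *)
Definition mean_law : 'I_q.+1 -> R :=
  softmax (fun r => t.1 * mean_gap r + ext_field t.2 r).

Definition centered_row_sum i : R := row_sum A i - mean_row_sum A.

(** The weight carried by the spin at [j] when gaps are averaged against the centred row sums, as in
    [average_color_gap]. *)
Definition centered_weight j : R := \sum_i centered_row_sum i * A i j.

Lemma residual_color_weight w s : residual A t (color_weight w s) x =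
  \sum_i w i * ((x i == s)%:R - cond_law A t x i s).
Proof.
apply: eq_bigr => i _; rewrite /residual_at /color_weight mulrBr; congr (_ - _).
under eq_bigr => r _ do rewrite eq_sym mulrCA mulrA.
by rewrite sum_color_indicator.
Qed.

Lemma ext_field_last (B : 'rV[R]_q.+1.-1) : ext_field B ord_max = 0.
Proof. by rewrite /ext_field insubN //= ltnn. Qed.

Lemma color_gap_last i : color_gap i ord_max = 0.
Proof. by rewrite /color_gap subrr. Qed.

Lemma mean_gap_last : mean_gap ord_max = 0.
Proof.
rewrite /mean_gap -[RHS](@average_cst R N N0) /average.
by congr (_ * _); apply: eq_bigr => i _; rewrite color_gap_last.
Qed.

Lemma color_gap_diff_le i r s : `|color_gap i s - color_gap i r| <= gamma.
Proof.
have := local_field_ge0 Age0 x i s; have := local_field_ge0 Age0 x i r.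
have := local_field_le Age0 Abound x i s.
have := local_field_le Age0 Abound x i r.
by rewrite /color_gap ler_norml => *; apply/andP; split; lra.
Qed.

Lemma mean_gap_diff_le r s : `|mean_gap s - mean_gap r| <= gamma.
Proof.
rewrite -averageB; apply: (average_norm_le N0) => i.
exact: color_gap_diff_le.
Qed.

Lemma mean_gap_norm_le r : `|mean_gap r| <= gamma.
Proof. by have := mean_gap_diff_le ord_max r; rewrite mean_gap_last subr0. Qed.

Lemma mean_energy_spread r s :
  t.1 * mean_gap s + ext_field t.2 s - (t.1 * mean_gap r + ext_field t.2 r) <=
  energy_spread gamma t.
Proof.
have hs := ext_field_norm_le t s; have hr := ext_field_norm_le t r.
have h : t.1 * (mean_gap s - mean_gap r) <= `|t.1| * gamma.
  apply: le_trans (ler_norm _) _; rewrite normrM ler_wpM2l //.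
  exact: mean_gap_diff_le.
have := ler_norm (ext_field t.2 s); have := ler_norm (- ext_field t.2 r).
rewrite normrN /energy_spread mulrBr in h *; lra.
Qed.

Lemma cond_law_gap i : cond_law A t x i =
  softmax (fun r => t.1 * color_gap i r + ext_field t.2 r).
Proof.
rewrite -(softmax_shift _ (t.1 * local_field A x i ord_max)); congr softmax.
by apply/funext => r; rewrite /local_energy /color_gap; ring.
Qed.

Definition law_lip (g : R) (u : param R q.+1) : R :=
  expR (energy_spread g u) * (`|u.1| * (2 * q.+1%:R)).

Lemma cond_law_mean_law i r : `|cond_law A t x i r - mean_law r| <=
  expR (energy_spread gamma t) *
    (`|t.1| * (\sum_s `|color_gap i s - mean_gap s| +
              q.+1%:R * `|color_gap i r - mean_gap r|)).
Proof.
rewrite cond_law_gap.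
apply: le_trans (softmax_lip (L := energy_spread gamma t) _ _) _.
- move=> s; apply: le_trans (local_energy_spread Age0 Abound t x i r s).
  rewrite /local_energy /color_gap le_eqVlt; apply/orP; left; apply/eqP.
  by ring.
- by move=> s; apply: mean_energy_spread.
have h s : `|t.1 * color_gap i s + ext_field t.2 s -
      (t.1 * mean_gap s + ext_field t.2 s)| =
    `|t.1| * `|color_gap i s - mean_gap s|.
  by rewrite -normrM; congr (`| _ |); ring.
under eq_bigr do rewrite !h -mulrDr.
rewrite -mulr_sumr big_split /= sumr_const card_ord.
by rewrite -[_ *+ q.+1]mulr_natl.
Qed.

Context {tau : R} (tau0 : 0 < tau) (var_le : gap_variance <= tau ^+ 2).

Lemma average_gap_deviation r :
  average (fun i => `|color_gap i r - mean_gap r|) <= tau.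
Proof.
have tau_gt0 := tau0.
(* Young's inequality tuned to [tau], to pass from the second moment to the first. *)
have h y : `|y| <= (2 * tau)^-1 * y ^+ 2 + tau / 2.
  rewrite -[y ^+ 2]real_normK ?num_real //; move: (normr_ge0 y).
  move: `|y| => z z0; have := sqr_ge0 (z - tau) => hz.
  rewrite -(ler_pM2l (x := 2 * tau)); last by rewrite mulr_gt0.
  have -> : 2 * tau * ((2 * tau)^-1 * z ^+ 2 + tau / 2) = z ^+ 2 + tau ^+ 2.
    by field; lra.
  by nra.
apply: le_trans (average_le (fun i => h (color_gap i r - mean_gap r))) _.
rewrite averageD average_cst // averageZ.
have : average (fun i => (color_gap i r - mean_gap r) ^+ 2) <= tau ^+ 2.
  apply: le_trans var_le; apply: average_le => i.
  by rewrite [leRHS](bigD1 r) //= lerDl sumr_ge0 // => s _; rewrite sqr_ge0.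
rewrite -(ler_pM2l (x := (2 * tau)^-1)); last by rewrite invr_gt0; lra.
have -> : (2 * tau)^-1 * tau ^+ 2 = tau / 2 by field; lra.
by move=> h1; lra.
Qed.

Lemma average_law_deviation r :
  average (fun i => `|cond_law A t x i r - mean_law r|) <=
  law_lip gamma t * tau.
Proof.
apply: le_trans (average_le (cond_law_mean_law^~ r)) _.
rewrite averageZ /law_lip -!mulrA ler_pM2l ?expR_gt0 // averageZ ler_wpM2l //.
rewrite averageD averageZ average_sum.
have h : \sum_s average (fun i => `|color_gap i s - mean_gap s|) <=
    q.+1%:R * tau.
  rewrite mulr_natl -[X in _ *+ X](card_ord q.+1) -sumr_const.
  by apply: ler_sum => s _; apply: average_gap_deviation.
have h' : q.+1%:R * average (fun i => `|color_gap i r - mean_gap r|) <=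
    q.+1%:R * tau by rewrite ler_wpM2l // average_gap_deviation.
lra.
Qed.

(** The difference splits into a residual, at most [tau] after division by [N], and a [w]-average of
    [cond_law - mean_law]. *)
Lemma average_weighted_color w W s : 0 <= W -> (forall i, `|w i| <= W) ->
    `|residual A t (color_weight w s) x| <= tau * N%:R ->
  `|average (fun i => w i * (x i == s)%:R) - mean_law s * average w| <=
  (1 + W * law_lip gamma t) * tau.
Proof.
move=> W0 hW hres.
have -> : average (fun i => w i * (x i == s)%:R) - mean_law s * average w =
    N%:R^-1 * residual A t (color_weight w s) x +
    average (fun i => w i * (cond_law A t x i s - mean_law s)).
  rewrite residual_color_weight -averageZ -averageB.
  rewrite -[N%:R^-1 * _]/(average _) -averageD.
  by congr average; apply/funext => i; ring.
apply: le_trans (ler_normD _ _) _; rewrite mulrDl mul1r lerD //.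
  rewrite normrM ger0_norm ?invr_ge0 // mulrC ler_pdivrMr ?ltr0n //.
apply: le_trans (average_norm _) _.
apply: (@le_trans _ _
    (average (fun i => W * `|cond_law A t x i s - mean_law s|))).
  by apply: average_le => i; rewrite normrM ler_wpM2r.
by rewrite averageZ -mulrA ler_wpM2l // average_law_deviation.
Qed.

Lemma average_weighted_color_diff w W r : 0 <= W -> (forall i, `|w i| <= W) ->
    (forall s, `|residual A t (color_weight w s) x| <= tau * N%:R) ->
  `|average (fun i => w i * ((x i == r)%:R - (x i == ord_max)%:R)) -
     (mean_law r - mean_law ord_max) * average w| <=
  2 * (1 + W * law_lip gamma t) * tau.
Proof.
move=> W0 hW hres.
have h1 := average_weighted_color W0 hW (hres r).
have h2 := average_weighted_color W0 hW (hres ord_max).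
have -> : average (fun i => w i * ((x i == r)%:R - (x i == ord_max)%:R)) =
    average (fun i => w i * (x i == r)%:R) -
    average (fun i => w i * (x i == ord_max)%:R).
  by rewrite -averageB; congr average; apply/funext => i; rewrite mulrBr.
move: h1 h2; rewrite !ler_norml => /andP[? ?] /andP[? ?].
by apply/andP; split; lra.
Qed.

(** Exchanging the sums moves [A] from the spins to the weights: averaged gaps become weighted color
    counts, to which the residual bounds apply. *)
Lemma average_color_gap (u : 'I_N -> R) r :
  average (fun i => u i * color_gap i r) =
  average (fun j => (\sum_i u i * A i j) *
    ((x j == r)%:R - (x j == ord_max)%:R)).
Proof.
rewrite /average; congr (_ * _).
under [RHS]eq_bigr do rewrite mulr_suml.
rewrite [RHS]exchange_big; apply: eq_bigr => i _ /=.
rewrite /color_gap /local_field -sumrB mulr_sumr.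
by apply: eq_bigr => j _; ring.
Qed.

End ColorGaps.

(** * A small gap variance forces a small external field *)

Section Irregularity.
Context {R : realType} {q : nat}.

(** This constant and the next two are the factors of [tau] in the bounds on [pi_r - pi_last], on
    [mean_gap] and on [ext_field]; [d] is the lower bound on the variance of the row sums. *)
Definition gap_const (g d : R) (t : param R q.+1) : R :=
  (g + 2 * (1 + g ^+ 2 * law_lip g t)) / d.

Definition mean_gap_const (g d : R) (t : param R q.+1) : R :=
  2 * (1 + g * law_lip g t) + g * gap_const g d t.

Definition field_const (g d : R) (t : param R q.+1) : R :=
  `|t.1| * mean_gap_const g d t +
  q.+1%:R * expR (2 * energy_spread g t) * gap_const g d t.

Context {N : nat} (A : 'M[R]_N) (gamma delta : R).
Context (Asym : A^T = A) (Age0 : forall i j, 0 <= A i j).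
Context (Abound : forall i, row_sum A i <= gamma) (N0 : (0 < N)%N).
Context (delta0 : 0 < delta).
Context (irregular : delta <= average (fun i => centered_row_sum A i ^+ 2)).
Context (t : param R q.+1) (x : config q.+1 N) (tau : R).
Context (tau0 : 0 < tau) (var_le : gap_variance A x <= tau ^+ 2).
Context (res_row : forall s,
  `|residual A t (color_weight (row_sum A) s) x| <= tau * N%:R).
Context (res_centered : forall s,
  `|residual A t (color_weight (centered_weight A) s) x| <= tau * N%:R).

Lemma entry_sym i j : A i j = A j i.
Proof. by rewrite -{1}Asym mxE. Qed.

Lemma gamma_ge0 : 0 <= gamma.
Proof. exact: le_trans (row_sum_ge0 Age0 _) (Abound (Ordinal N0)). Qed.

Lemma row_sum_norm_le i : `|row_sum A i| <= gamma.
Proof. by rewrite ger0_norm ?row_sum_ge0. Qed.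

Lemma centered_row_sum_norm_le i : `|centered_row_sum A i| <= gamma.
Proof.
have m0 : 0 <= mean_row_sum A.
  by rewrite mulr_ge0 ?invr_ge0 // sumr_ge0 // => k _; apply: row_sum_ge0.
have m1 : mean_row_sum A <= gamma.
  by rewrite -(average_cst N0 gamma) average_le.
have := row_sum_ge0 Age0 i; have := Abound i.
by rewrite /centered_row_sum ler_norml => *; apply/andP; split; lra.
Qed.

Lemma centered_weight_norm_le j : `|centered_weight A j| <= gamma ^+ 2.
Proof.
apply: le_trans (ler_norm_sum _ _ _) _.
apply: (@le_trans _ _ (\sum_i gamma * A j i)).
  apply: ler_sum => i _; rewrite normrM entry_sym (ger0_norm (Age0 _ _)).
  by rewrite ler_wpM2r // centered_row_sum_norm_le.
by rewrite -mulr_sumr expr2 ler_wpM2l ?gamma_ge0 // Abound.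
Qed.

Lemma average_centered_row_sum : average (centered_row_sum A) = 0.
Proof. exact: average_centered. Qed.

Lemma average_centered_weight :
  average (centered_weight A) = average (fun i => centered_row_sum A i ^+ 2).
Proof.
transitivity (average (fun i => centered_row_sum A i * row_sum A i)).
  rewrite /average /centered_weight exchange_big; congr (_ * _).
  by apply: eq_bigr => i _; rewrite -mulr_sumr.
have -> : (fun i => centered_row_sum A i * row_sum A i) =
    (fun i =>
      centered_row_sum A i ^+ 2 + mean_row_sum A * centered_row_sum A i).
  by apply/funext => i; rewrite /centered_row_sum; ring.
by rewrite averageD averageZ average_centered_row_sum mulr0 addr0.
Qed.

Lemma average_centered_gap_norm_le r :
  `|average (fun i => centered_row_sum A i * color_gap A x i r)| <= gamma * tau.
Proof.
have -> : average (fun i => centered_row_sum A i * color_gap A x i r) =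
    average
      (fun i => centered_row_sum A i * (color_gap A x i r - mean_gap A x r)).
  rewrite -[LHS]subr0 -(mulr0 (mean_gap A x r)) -average_centered_row_sum.
  by rewrite -averageZ -averageB; congr average; apply/funext => i; ring.
apply: le_trans (average_norm _) _.
apply: (@le_trans _ _
    (average (fun i => gamma * `|color_gap A x i r - mean_gap A x r|))).
  apply: average_le => i.
  by rewrite normrM ler_wpM2r // centered_row_sum_norm_le.
rewrite averageZ ler_wpM2l ?gamma_ge0 //.
exact: average_gap_deviation.
Qed.

(** The average of the gaps against the centred row sums is [O(tau)], yet up to [O(tau)] it is
    [pi_r - pi_last] times the variance of the row sums; irregularity permits division by
    [delta]. *)
Lemma mean_law_gap_le r :
  `|mean_law A t x r - mean_law A t x ord_max| <= gap_const gamma delta t * tau.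
Proof.
have := average_weighted_color_diff Age0 Abound N0 tau0 var_le r
  (sqr_ge0 gamma) centered_weight_norm_le res_centered.
rewrite -average_color_gap average_centered_weight => h.
have hg := average_centered_gap_norm_le r.
set p := _ - mean_law A t x ord_max; rewrite -/p in h.
have : `|p| * average (fun i => centered_row_sum A i ^+ 2) <=
    (gamma + 2 * (1 + gamma ^+ 2 * law_lip gamma t)) * tau.
  rewrite -[X in _ * X]ger0_norm; last exact: le_trans (ltW delta0) irregular.
  rewrite -normrM; move: h hg; move: (average _) (p * _) => a b.
  by rewrite !ler_norml => /andP[? ?] /andP[? ?]; apply/andP; split; lra.
move=> {}h; rewrite /gap_const mulrAC ler_pdivlMr //; apply: le_trans h.
by rewrite ler_wpM2l.
Qed.

(** The same comparison with constant weights: by symmetry the spins then carry the weights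
    [row_sum A], whose average is at most [gamma], so the bound on [pi_r - pi_last] transfers to the
    mean gap. *)
Lemma mean_gap_le r : `|mean_gap A x r| <= mean_gap_const gamma delta t * tau.
Proof.
have := average_weighted_color_diff Age0 Abound N0 tau0 var_le r
  gamma_ge0 row_sum_norm_le res_row.
have -> : average (fun i => row_sum A i * ((x i == r)%:R - (x i == ord_max)%:R))
    = mean_gap A x r.
  have -> : mean_gap A x r = average (fun i => 1 * color_gap A x i r).
    by congr average; apply/funext => i; rewrite mul1r.
  rewrite average_color_gap; congr average; apply/funext => j; congr (_ * _).
  by apply: eq_bigr => i _; rewrite mul1r -{1}Asym mxE.
move=> h; have hp := mean_law_gap_le r.
have : `|(mean_law A t x r - mean_law A t x ord_max) * average (row_sum A)| <=
    gamma * (gap_const gamma delta t * tau).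
  rewrite normrM mulrC; apply: ler_pM => //.
  exact: (average_norm_le N0 row_sum_norm_le).
rewrite /mean_gap_const; move: h; move: (mean_gap A x r) (_ * average _) => a b.
by rewrite !ler_norml => /andP[? ?] /andP[? ?]; apply/andP; split; lra.
Qed.

Lemma ext_field_le_tau r :
  `|ext_field t.2 r| <= field_const gamma delta t * tau.
Proof.
(* [z] is the log-ratio of [mean_law] at [r] and at the last color. *)
set z := t.1 * mean_gap A x r + ext_field t.2 r.
have hz : `|z| <= energy_spread gamma t.
  have := mean_energy_spread Age0 Abound N0 t x ord_max r.
  have := mean_energy_spread Age0 Abound N0 t x r ord_max.
  rewrite mean_gap_last // ext_field_last mulr0 addr0 -/z ler_norml => *.
  by apply/andP; split; lra.
have pE : mean_law A t x r - mean_law A t x ord_max =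
    mean_law A t x ord_max * (expR z - 1).
  rewrite /mean_law /softmax mean_gap_last // ext_field_last mulr0 addr0 expR0.
  by rewrite -/z; ring.
have pl : expR (- energy_spread gamma t) / q.+1%:R <= mean_law A t x ord_max.
  have := softmax_ge (fun s => mean_energy_spread Age0 Abound N0 t x ord_max s).
  by rewrite card_ord.
have hp := mean_law_gap_le r; rewrite pE normrM gtr0_norm ?softmax_gt0 // in hp.
have he := norm_expR_sub1_ge hz.
(* One factor [expR (- energy_spread gamma t)] comes from the lower bound on [mean_law] at the last
   color, the other from [norm_expR_sub1_ge]. *)
have zle : `|z| <=
    q.+1%:R * expR (2 * energy_spread gamma t) * gap_const gamma delta t * tau.
  rewrite -[leRHS]mulrA mulrC -ler_pdivrMr; last first.
    by rewrite mulr_gt0 ?expR_gt0 // ltr0n.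
  apply: le_trans hp.
  have -> : `|z| / (q.+1%:R * expR (2 * energy_spread gamma t)) =
      expR (- energy_spread gamma t) / q.+1%:R *
      (expR (- energy_spread gamma t) * `|z|).
    rewrite invfM -expRN.
    have -> : - (2 * energy_spread gamma t) =
      - energy_spread gamma t - energy_spread gamma t by ring.
    by rewrite expRD; ring.
  by apply: ler_pM => //; rewrite ?divr_ge0 ?mulr_ge0 ?expR_ge0.
have -> : ext_field t.2 r = z - t.1 * mean_gap A x r by rewrite /z; ring.
apply: le_trans (ler_normB _ _) _; rewrite normrM /field_const mulrDl addrC.
by rewrite lerD // -mulrA ler_wpM2l // mean_gap_le.
Qed.

End Irregularity.

(** * Concavity of the log pseudo-likelihood *)

Section PseudoLikelihood.
Context {R : realType} {q N : nat}.
Context (A : 'M[R]_N) (x : config q.+1 N).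
Implicit Types (t u p : param R q.+1) (c : R) (r s : 'I_q.+1) (i : 'I_N).

Definition along t c u : param R q.+1 := (t.1 + c * u.1, t.2 + c *: u.2).

Definition displacement t p : param R q.+1 := (p.1 - t.1, p.2 - t.2).

(** The derivative of [log_pl] at [t] in the direction [u]; it is a residual because the local
    energy is linear in the parameter. *)
Definition score t u : R :=
  residual A t (fun i y => local_energy A u y i) x.

Lemma along_displacement t p : along t 1 (displacement t p) = p.
Proof.
case: p => p1 p2; rewrite /along /displacement /= scale1r mul1r.
by rewrite addrC subrK addrC subrK.
Qed.

Lemma along_along t u a c : along (along t a u) c u = along t (a + c) u.
Proof. by rewrite /along /= -!addrA -mulrDl -scalerDl. Qed.

Lemma along0 t u : along t 0 u = t.
Proof. by case: t => a b; rewrite /along /= mul0r scale0r !addr0. Qed.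

Lemma ext_field_along (B C : 'rV[R]_q.+1.-1) c r :
  ext_field (B + c *: C) r = ext_field B r + c * ext_field C r.
Proof.
rewrite /ext_field; case: insubP => [k _ _|_]; first by rewrite !mxE.
by rewrite mulr0 addr0.
Qed.

Lemma local_energy_along t c u i r : local_energy A (along t c u) x i r =
  local_energy A t x i r + c * local_energy A u x i r.
Proof. by rewrite /local_energy /= ext_field_along; ring. Qed.

Lemma log_plE t : log_pl A x t =
  \sum_i
    (local_energy A t x i (x i) - ln (partition_fun (local_energy A t x i))).
Proof.
rewrite /log_pl sumrB; congr (_ - _).
rewrite mulr_sumr -big_split /=; apply: eq_bigr => i _.
by rewrite !sum_color_indicator.
Qed.

(** The subtracted terms are Bregman divergences of the log-partition function, so each convexity
    estimate on the latter becomes a concavity estimate on [log_pl]. *)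
Lemma log_pl_along t c u : log_pl A x (along t c u) =
  log_pl A x t + c * score t u - \sum_i
   (ln (partition_fun
      (fun r => local_energy A t x i r + c * local_energy A u x i r)) -
    ln (partition_fun (local_energy A t x i)) -
    softmax_mean (local_energy A t x i) (fun r => c * local_energy A u x i r)).
Proof.
rewrite !log_plE /score /residual mulr_sumr -big_split -sumrB /=.
apply: eq_bigr => i _; rewrite /residual_at local_energy_along.
have -> : local_energy A (along t c u) x i =
    fun r => local_energy A t x i r + c * local_energy A u x i r.
  by apply/funext => r; apply: local_energy_along.
have -> : softmax_mean (local_energy A t x i)
      (fun r => c * local_energy A u x i r) =
    c * \sum_r cond_law A t x i r * local_energy A u x i r.
  by rewrite mulr_sumr; apply: eq_bigr => r _; rewrite mulrCA.
by ring.
Qed.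

Lemma log_pl_tangent t c u :
  log_pl A x (along t c u) <= log_pl A x t + c * score t u.
Proof.
rewrite log_pl_along gerBl sumr_ge0 // => i _.
by rewrite -addrA -opprD subr_ge0 (ln_partition_fun_tangent _ _ (x i)).
Qed.

Lemma log_pl_tangent_lt t c u i r s : c != 0 ->
    local_energy A u x i r != local_energy A u x i s ->
  log_pl A x (along t c u) < log_pl A x t + c * score t u.
Proof.
move=> c0 urs; rewrite log_pl_along gtrBl (bigD1 i) //= ltr_pwDl //.
  rewrite -addrA -opprD subr_gt0 (@ln_partition_fun_tangent_lt _ _ _ _ r s) //.
  by apply: contra urs => /eqP/(mulfI c0)->.
apply: sumr_ge0 => j _.
by rewrite -addrA -opprD subr_ge0 (ln_partition_fun_tangent _ _ (x j)).
Qed.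

Lemma log_pl_quad t u c : 0 <= c ->
    (forall i r, c <= cond_law A t x i r) ->
    (forall i r, `|local_energy A u x i r| <= 1) ->
  log_pl A x (along t 1 u) <= log_pl A x t + score t u -
    c / (16 * q.+1%:R) * \sum_i \sum_r
      (u.1 * color_gap A x i r + ext_field u.2 r) ^+ 2.
Proof.
move=> c0 hc hu; rewrite log_pl_along mul1r lerD2l lerN2 mulr_sumr.
apply: ler_sum => i _.
have := ln_partition_fun_quad ord_max c0 (hc i) (hu i); rewrite card_ord.
have -> : (fun r => 1 * local_energy A u x i r) = local_energy A u x i.
  by apply/funext => r; rewrite mul1r.
have -> : (fun r => local_energy A t x i r + 1 * local_energy A u x i r) =
    (fun r => local_energy A t x i r + local_energy A u x i r).
  by apply/funext => r; rewrite mul1r.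
have -> : \sum_r (u.1 * color_gap A x i r + ext_field u.2 r) ^+ 2 =
    \sum_r (local_energy A u x i r - local_energy A u x i ord_max) ^+ 2.
  apply: eq_bigr => r _; congr (_ ^+ 2).
  by rewrite /local_energy /color_gap ext_field_last; ring.
by rewrite !lerBrDl addrA.
Qed.

Lemma norm2_ge0 u : 0 <= norm2 u.
Proof. exact: sqrtr_ge0. Qed.

Lemma norm2_sqr u : norm2 u ^+ 2 = u.1 ^+ 2 + \sum_k u.2 0 k ^+ 2.
Proof.
rewrite sqr_sqrtr // addr_ge0 ?sqr_ge0 // sumr_ge0 // => k _.
exact: sqr_ge0.
Qed.

Lemma norm2_sqr_ext u :
  norm2 u ^+ 2 = u.1 ^+ 2 + \sum_r ext_field u.2 r ^+ 2.
Proof.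
rewrite norm2_sqr [in RHS]big_ord_recr /= ext_field_last expr0n addr0.
congr (_ + _); apply: eq_bigr => k _; congr (_ ^+ 2).
rewrite /ext_field; case: insubP => [j _ jk|]; last by rewrite /= ltn_ord.
by congr (u.2 0 _); apply: val_inj.
Qed.

Lemma norm2_scale c u : 0 <= c -> norm2 (c * u.1, c *: u.2) = c * norm2 u.
Proof.
move=> c0; rewrite /norm2 /=; have -> : (c * u.1) ^+ 2 +
    \sum_k (c *: u.2) 0 k ^+ 2 = c ^+ 2 * (u.1 ^+ 2 + \sum_k u.2 0 k ^+ 2).
  rewrite mulrDr mulr_sumr exprMn; congr (_ + _).
  by apply: eq_bigr => k _; rewrite mxE exprMn.
by rewrite sqrtrM ?sqr_ge0 // sqrtr_sqr ger0_norm.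
Qed.

Lemma norm2_fst_le u : `|u.1| <= norm2 u.
Proof.
rewrite -sqrtr_sqr ler_wsqrtr // lerDl sumr_ge0 // => k _; exact: sqr_ge0.
Qed.

Lemma norm2_snd_le u k : `|u.2 0 k| <= norm2 u.
Proof.
rewrite -sqrtr_sqr ler_wsqrtr // (bigD1 k) //= addrCA lerDl.
by rewrite addr_ge0 ?sqr_ge0 // sumr_ge0 // => j _; exact: sqr_ge0.
Qed.

Lemma norm2_gt0 t p : t != p -> 0 < norm2 (displacement t p).
Proof.
move=> tp; rewrite lt_def norm2_ge0 andbT; apply: contra tp => /eqP e.
have h1 := norm2_fst_le (displacement t p); rewrite e normr_le0 subr_eq0 in h1.
have h2 k := norm2_snd_le (displacement t p) k.
have e2 : p.2 = t.2.
  by apply/rowP => k; have := h2 k; rewrite e normr_le0 !mxE subr_eq0 => /eqP.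
move: h1 e2; clear; case: t p => [a b] [c d] /= /eqP -> ->.
exact: eqxx.
Qed.

(** The score is linear in [u]; Cauchy-Schwarz separates [u] from the residuals, so one event
    controls all directions at once. *)
Lemma score_sqr_le t u : score t u ^+ 2 <= 2 * norm2 u ^+ 2 *
  (residual A t (fun i y r => local_field A y i r) x ^+ 2 +
   \sum_s residual A t (color_weight (fun=> 1) s) x ^+ 2).
Proof.
pose a := residual A t (fun i y r => local_field A y i r) x.
pose b s := residual A t (color_weight (fun=> 1) s) x.
rewrite -/a; change (score t u ^+ 2 <=
  2 * norm2 u ^+ 2 * (a ^+ 2 + \sum_s b s ^+ 2)).
have -> : score t u = u.1 * a + \sum_s ext_field u.2 s * b s.
  rewrite /score /a /b /residual mulr_sumr.
  under [X in _ = _ + X]eq_bigr do rewrite mulr_sumr.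
  rewrite exchange_big -big_split /=; apply: eq_bigr => i _.
  rewrite /residual_at /color_weight /local_energy mulrBr.
  under [X in _ = _ + X]eq_bigr do rewrite mul1r mulrBr.
  rewrite sumrB sum_color_indicator.
  have -> : \sum_s ext_field u.2 s *
      (\sum_r cond_law A t x i r * (1 * (r == s)%:R)) =
    \sum_s ext_field u.2 s * cond_law A t x i s.
    apply: eq_bigr => s _; congr (_ * _).
    under eq_bigr do rewrite mul1r eq_sym.
    by rewrite sum_color_indicator.
  under [X in _ - X = _]eq_bigr do rewrite mulrDr.
  rewrite big_split /=.
  have -> : \sum_r cond_law A t x i r * (u.1 * local_field A x i r) =
      u.1 * \sum_r cond_law A t x i r * local_field A x i r.
    by rewrite mulr_sumr; apply: eq_bigr => r _; rewrite mulrCA.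
  under [X in _ - (_ + X) = _]eq_bigr do rewrite mulrC.
  by ring.
have hs := cauchy_sum (fun s => ext_field u.2 s) b.
rewrite norm2_sqr_ext; move: hs; move: (\sum_s _ * _) => z.
have e0 : 0 <= \sum_r ext_field u.2 r ^+ 2.
  by apply: sumr_ge0 => r _; apply: sqr_ge0.
have b0 : 0 <= \sum_s b s ^+ 2.
  by apply: sumr_ge0 => r _; apply: sqr_ge0.
move: (\sum_r _) e0 (\sum_s _) b0 => e e0 f f0 hz.
have := sqr_ge0 (u.1 * a - z); have := mulr_ge0 e0 (sqr_ge0 a).
have := mulr_ge0 f0 (sqr_ge0 u.1); nra.
Qed.

End PseudoLikelihood.

(** * Existence, uniqueness and location of the maximizer *)

Section Maximizer.
Context {R : realType} {q N : nat}.
Context (A : 'M[R]_N) (x : config q.+1 N).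
Implicit Types (t u p : param R q.+1).

Lemma continuous_sum (T : topologicalType) (I : finType) (F : I -> T -> R) :
  (forall i, continuous (F i)) -> continuous (fun z => \sum_i F i z).
Proof.
move=> cF; apply: continuous_big => [|i _]; last exact: cF.
exact: add_continuous.
Qed.

Lemma continuous_local_energy i r :
  continuous (fun p : R * 'rV[R]_q => local_energy A (p : param R q.+1) x i r).
Proof.
move=> p; apply: cvgD.
  by apply: cvgM; [exact: cvg_fst|exact: cvg_cst].
rewrite /ext_field; case: insubP => [k _ _|_]; last exact: cvg_cst.
apply: (@continuous_comp _ _ _ (fun p : R * 'rV[R]_q => p.2)
  (fun B : 'rV[R]_q => B 0 k)); first exact: cvg_snd.
exact: coord_continuous.
Qed.

Lemma continuous_log_pl :
  continuous (fun p : R * 'rV[R]_q => log_pl A x p).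
Proof.
have -> : (fun p : R * 'rV[R]_q => log_pl A x p) = (fun p => \sum_i
    (local_energy A (p : param R q.+1) x i (x i) -
     ln (partition_fun (local_energy A (p : param R q.+1) x i)))).
  by apply/funext => p; apply: log_plE.
apply: continuous_sum => i p; apply: cvgB; first exact: continuous_local_energy.
apply: (@continuous_comp _ _ _ (fun p : R * 'rV[R]_q =>
  partition_fun (local_energy A (p : param R q.+1) x i)) (@ln R)).
  apply: continuous_sum => r {}p.
  apply: (@continuous_comp _ _ _ (fun p : R * 'rV[R]_q =>
    local_energy A (p : param R q.+1) x i r) (@expR R)).
    exact: continuous_local_energy.
  exact: continuous_expR.
by apply: continuous_ln; apply: (partition_fun_gt0 _ (x i)).
Qed.

Context (t : param R q.+1) (rho : R) (rho0 : 0 < rho).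
Context (sphere : forall u, norm2 u = rho -> 
  log_pl A x (along t 1 u) < log_pl A x t).
Context (identifiable : forall u, 0 < norm2 u -> exists i r s,
  local_energy A u x i r != local_energy A u x i s).

Lemma log_pl_lt_outside p :
  rho < norm2 (displacement t p) -> log_pl A x p < log_pl A x t.
Proof.
set u := displacement t p => hu.
have n0 : 0 < norm2 u by apply: lt_trans hu.
pose c := rho / norm2 u.
have c0 : 0 < c by rewrite divr_gt0.
have c1 : c < 1 by rewrite ltr_pdivrMr // mul1r.
have y_lt : log_pl A x (along t c u) < log_pl A x t.
  have := sphere (u := (c * u.1, c *: u.2)).
  rewrite norm2_scale ?ltW // /c divfK ?gt_eqF // => /(_ erefl).
  by rewrite /along /= mul1r scale1r.
have := log_pl_tangent A x (along t c u) (1 - c) u.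
have := log_pl_tangent A x (along t c u) (- c) u.
have -> : along (along t c u) (1 - c) u = p.
  by rewrite along_along addrC subrK along_displacement.
rewrite along_along subrr along0.
set s := score _ _ _ _ => h1 h2.
(* The tangent bounds at the sphere point towards [p] and towards [t], weighted by [c] and [1 - c],
   cancel the score. As the sphere point lies below [t], so does [p]. *)
have : c * log_pl A x p + (1 - c) * log_pl A x t <= log_pl A x (along t c u).
  by nra.
by nra.
Qed.

Lemma unique_maximizer_near : exists p,
  unique (is_maximizer (log_pl A x)) p /\ norm2 (displacement t p) <= rho.
Proof.
have rho_gt0 := rho0.
(* A box, compact as a product of segments, that contains the Euclidean ball of radius [rho];
   outside it [log_pl_lt_outside] applies. *)
pose K : set (R * 'rV[R]_q) := `[t.1 - rho, t.1 + rho]%classic `*`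
  [set v : 'rV[R]_q | forall k,
    `[t.2 ord0 k - rho, t.2 ord0 k + rho]%classic (v ord0 k)].
have K_t : K t.
  split => /= [|k]; rewrite in_itv /=; apply/andP; split; lra.
have [] := @compact_EVT_max _ R (fun p : R * 'rV[R]_q => log_pl A x p) K.
- by exists t.
- apply: compact_setX; first exact: segment_compact.
  exact: (@rV_compact R q (fun k => _) (fun k => @segment_compact R _ _)).
- by apply: continuous_subspaceT; exact: continuous_log_pl.
move=> p _ pmax.
have p_max : is_maximizer (log_pl A x) p.
  move=> v; have [vK|vK] := pselect (K v); first by apply: pmax; rewrite inE.
  apply: (@le_trans _ _ (log_pl A x t)); last by apply: pmax; rewrite inE.
  have [hv|hv] := leP (norm2 (displacement t v)) rho; last first.
    exact/ltW/log_pl_lt_outside.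
  case: vK; split => /= [|k]; rewrite in_itv /=.
    have := le_trans (norm2_fst_le (displacement t v)) hv.
    by rewrite ler_norml /= => /andP[? ?]; apply/andP; split; lra.
  have := le_trans (norm2_snd_le (displacement t v) k) hv.
  by rewrite ler_norml /= !mxE => /andP[? ?]; apply/andP; split; lra.
exists p; split; last first.
  by rewrite leNgt; apply/negP => /log_pl_lt_outside; rewrite ltNge p_max.
split=> // v v_max; apply/eqP; apply/negPn/negP => pv.
(* Strict concavity at the midpoint of two distinct maximizers would give it a value above the
   maximum. *)
have [i [r [s urs]]] := identifiable (norm2_gt0 pv).
set u := displacement p v in urs.
have h2 : (1 - 2^-1 : R) != 0 by lra.
have h1 : (- 2^-1 : R) != 0 by lra.
have := log_pl_tangent_lt (along p 2^-1 u) h2 urs.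
have := log_pl_tangent_lt (along p 2^-1 u) h1 urs.
have -> : along (along p 2^-1 u) (1 - 2^-1) u = v.
  by rewrite along_along addrC subrK along_displacement.
rewrite along_along subrr along0.
have := p_max (along p 2^-1 u); have := v_max p.
set a := log_pl _ _ _; set b := log_pl _ _ _; set c := log_pl _ _ _.
set d := score _ _ _ _; lra.
Qed.

End Maximizer.

(** * Consistency *)

Section Consistency.
Context {R : realType} {q : nat}.
Implicit Types (t u p : param R q.+1).

(** A single statistic for a single use of Markov's inequality: the first two terms control the
    score, the last two the gap variance. *)
Definition residual_energy N (A : 'M[R]_N) t (x : config q.+1 N) : R :=
  residual A t (fun i y r => local_field A y i r) x ^+ 2 +
  \sum_s residual A t (color_weight (fun=> 1) s) x ^+ 2 +
  \sum_s residual A t (color_weight (row_sum A) s) x ^+ 2 +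
  \sum_s residual A t (color_weight (centered_weight A) s) x ^+ 2.

Definition identifiability_const (g v : R) : R :=
  2 + (2 * g ^+ 2 * q.+1%:R + 1) / v.

Section FixedSize.
Context {N : nat} {A : 'M[R]_N} {gamma : R}.
Context (Asym : A^T = A) (Adiag : forall i, A i i = 0).
Context (Age0 : forall i j, 0 <= A i j).
Context (Abound : forall i, row_sum A i <= gamma) (N0 : (0 < N)%N).

(** Bias-variance decomposition of the gaps around their means; the cross term averages to zero. *)
Lemma average_quadratic_form (x : config q.+1 N) u :
  average (fun i => \sum_r (u.1 * color_gap A x i r + ext_field u.2 r) ^+ 2) =
  u.1 ^+ 2 * gap_variance A x +
  \sum_r (u.1 * mean_gap A x r + ext_field u.2 r) ^+ 2.
Proof.
rewrite /gap_variance !average_sum mulr_sumr -big_split /=.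
apply: eq_bigr => r _; set m := mean_gap A x r; set g := u.1 * m + _.
have -> : (fun i => (u.1 * color_gap A x i r + ext_field u.2 r) ^+ 2) =
    (fun i => u.1 ^+ 2 * (color_gap A x i r - m) ^+ 2 +
      (2 * u.1 * g) * (color_gap A x i r - m) + g ^+ 2).
  by apply/funext => i; rewrite /g; ring.
rewrite averageD averageD !averageZ average_cst //.
by rewrite /m /mean_gap average_centered // mulr0 addr0.
Qed.

(** The variance term controls [u.1]; since mean gaps are at most [gamma], the squared mean term
    then controls the field coordinates. *)
Lemma norm2_le_quadratic_form (x : config q.+1 N) u v :
    0 < v -> v <= gap_variance A x ->
  norm2 u ^+ 2 <= identifiability_const gamma v *
    average (fun i =>
      \sum_r (u.1 * color_gap A x i r + ext_field u.2 r) ^+ 2).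
Proof.
move=> v0 hv; rewrite average_quadratic_form norm2_sqr_ext.
have g0 := gamma_ge0 Age0 Abound N0.
have h : \sum_r ext_field u.2 r ^+ 2 <=
    2 * (\sum_r (u.1 * mean_gap A x r + ext_field u.2 r) ^+ 2) +
    2 * gamma ^+ 2 * q.+1%:R * u.1 ^+ 2.
  have -> : 2 * gamma ^+ 2 * q.+1%:R * u.1 ^+ 2 =
      \sum_(r < q.+1) 2 * gamma ^+ 2 * u.1 ^+ 2.
    by rewrite sumr_const card_ord -[_ *+ q.+1]mulr_natr; ring.
  rewrite mulr_sumr -big_split /=; apply: ler_sum => r _.
  have : mean_gap A x r ^+ 2 <= gamma ^+ 2.
    rewrite -real_normK ?num_real // ler_sqr ?nnegrE //.
    exact: mean_gap_norm_le.
  move: (mean_gap _ _ _) (ext_field _ _) => m b hm.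
  have := ler_wpM2l (sqr_ge0 u.1) hm; have := sqr_ge0 (u.1 * m + (u.1 * m + b)).
  by nra.
set S := \sum_r (_ + _) ^+ 2 in h *.
have S0 : 0 <= S by apply: sumr_ge0 => r _; apply: sqr_ge0.
set c := 2 * gamma ^+ 2 * q.+1%:R in h *.
have c0 : 0 <= c by rewrite mulr_ge0 // mulr_ge0 // sqr_ge0.
have u0 := sqr_ge0 u.1.
have d0 : 0 <= (c + 1) / v by rewrite divr_ge0 ?ltW //; lra.
have h1 : (c + 1) * u.1 ^+ 2 <= (c + 1) / v * (u.1 ^+ 2 * gap_variance A x).
  rewrite -mulrA ler_wpM2l //; first lra.
  by rewrite mulrCA ler_peMr // mulrC ler_pdivlMr // mul1r.
have h2 : 0 <= u.1 ^+ 2 * gap_variance A x by rewrite mulr_ge0 //; lra.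
rewrite /identifiability_const -/c mulrDr !mulrDl.
have h3 := mulr_ge0 d0 S0; lra.
Qed.

Lemma identifiable_of_variance (x : config q.+1 N) u :
    0 < gap_variance A x -> 0 < norm2 u ->
  exists i r s, local_energy A u x i r != local_energy A u x i s.
Proof.
move=> v0 u0; apply: contrapT => no.
have e i r : u.1 * color_gap A x i r + ext_field u.2 r = 0.
  have -> : u.1 * color_gap A x i r + ext_field u.2 r =
      local_energy A u x i r - local_energy A u x i ord_max.
    by rewrite /local_energy /color_gap ext_field_last; ring.
  apply/eqP; rewrite subr_eq0; apply/negPn/negP => ne; apply: no.
  by exists i, r, ord_max.
have := norm2_le_quadratic_form (x := x) u v0 (lexx _).
rewrite /average big1 ?mulr0 => [|i _]; last first.
  by rewrite big1 // => r _; rewrite e expr0n.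
by rewrite leNgt exprn_gt0.
Qed.

Lemma local_energy_norm_le (x : config q.+1 N) u i r :
  `|local_energy A u x i r| <= norm2 u * (gamma + 1).
Proof.
have m0 := local_field_ge0 Age0 x i r.
have m1 := local_field_le Age0 Abound x i r.
apply: le_trans (ler_normD _ _) _; rewrite mulrDr mulr1 lerD //.
  by rewrite normrM (ger0_norm m0) ler_pM // norm2_fst_le.
rewrite -ler_sqr ?nnegrE ?norm2_ge0 // real_normK ?num_real // norm2_sqr_ext.
rewrite (bigD1 r) //= addrCA lerDl addr_ge0 ?sqr_ge0 //.
by rewrite sumr_ge0 // => s _; apply: sqr_ge0.
Qed.

Definition cond_law_min (g : R) t : R := expR (- energy_spread g t) / q.+1%:R.

Lemma cond_law_ge (x : config q.+1 N) t i r :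
  cond_law_min gamma t <= cond_law A t x i r.
Proof.
have := softmax_ge (local_energy_spread Age0 Abound t x i r).
by rewrite card_ord.
Qed.

(** The factor of [N%:R * norm2 u ^+ 2] in the quadratic loss given by [log_pl_quad] and
    [norm2_le_quadratic_form]. *)
Definition curvature (g v : R) t : R :=
  cond_law_min g t / (16 * q.+1%:R) / identifiability_const g v.

(** At radius [K / sqrt N] the quadratic loss is at least [curvature * K ^+ 2], while the squared
    score is at most [2 * M * K ^+ 2], so the loss wins for such [K]. The last hypothesis brings the
    local energies into the range of [log_pl_quad]. *)
Lemma log_pl_lt_sphere (x : config q.+1 N) t u v M K :
    0 < v -> v <= gap_variance A x -> 0 < K ->
    residual_energy A t x <= M * N%:R ->
    2 * M < (curvature gamma v t * K) ^+ 2 ->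
    norm2 u ^+ 2 = K ^+ 2 / N%:R -> norm2 u * (gamma + 1) <= 1 ->
  log_pl A x (along t 1 u) < log_pl A x t.
Proof.
move=> v0 hv K0 hM hK hu hu1.
have Np : 0 < N%:R :> R by rewrite ltr0n.
have g0 := gamma_ge0 Age0 Abound N0.
have c0 : 0 < cond_law_min gamma t by rewrite divr_gt0 ?expR_gt0.
have d0 : 0 < identifiability_const gamma v.
  rewrite /identifiability_const ltr_pwDl // divr_ge0 ?ltW //.
  by rewrite ltr_wpDl // mulr_ge0 // mulr_ge0 // sqr_ge0.
have k0 : 0 < curvature gamma v t 
  by do 2!apply: divr_gt0 => //; rewrite mulr_gt0 ?ltr0n.
have := log_pl_quad (ltW c0) (cond_law_ge x t)
  (fun i r => le_trans (local_energy_norm_le x u i r) hu1).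
have := score_sqr_le A x t u.
set F := \sum_i _; set a := _ + \sum_s _.
have aM : a <= M * N%:R.
  apply: le_trans hM; rewrite /residual_energy -/a -addrA lerDl addr_ge0 //.
    by apply: sumr_ge0 => s _; apply: sqr_ge0.
  by apply: sumr_ge0 => s _; apply: sqr_ge0.
have hF : curvature gamma v t * K ^+ 2 <=
    cond_law_min gamma t / (16 * q.+1%:R) * F.
  rewrite /curvature -mulrA ler_wpM2l //.
    by rewrite divr_ge0 ?mulr_ge0 // ltW.
  rewrite ler_pdivrMl //.
  have := norm2_le_quadratic_form u v0 hv; rewrite hu /average -/F.
  by rewrite [leRHS]mulrCA [leLHS]mulrC ler_pM2l ?invr_gt0.
set s := score A x t u => hs hq.
have s2 : s ^+ 2 < (curvature gamma v t * K ^+ 2) ^+ 2.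
  apply: le_lt_trans hs _.
  apply: (@le_lt_trans _ _ (2 * norm2 u ^+ 2 * (M * N%:R))).
    by rewrite ler_wpM2l // mulr_ge0 // sqr_ge0.
  have -> : 2 * norm2 u ^+ 2 * (M * N%:R) = K ^+ 2 * (2 * M).
    by rewrite hu; field; rewrite gt_eqF.
  have -> : (curvature gamma v t * K ^+ 2) ^+ 2 =
    K ^+ 2 * (curvature gamma v t * K) ^+ 2 by ring.
  by rewrite ltr_pM2l ?exprn_gt0.
have : s < curvature gamma v t * K ^+ 2.
  rewrite ltNge; apply/negP => hle.
  have h0 : 0 <= curvature gamma v t * K ^+ 2.
    by rewrite mulr_ge0 ?sqr_ge0 // ltW.
  by move: s2; rewrite ltNge ler_sqr ?nnegrE // ?hle // (le_trans h0).
move=> s_lt; apply: le_lt_trans hq _.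
by rewrite ltrBlDr ltrD2l (lt_le_trans s_lt).
Qed.

End FixedSize.
End Consistency.

(** * Mean of the residual energy, and the maximizer when that energy is of order N *)

Section Assembly.
Context {R : realType} {q : nat}.
Implicit Types (t : param R q.+1).

Definition moment_const (g K L : R) t : R :=
  4 * K ^+ 2 + 2 * K * residual_lip g t K L * g.

Definition residual_energy_const (g : R) t : R :=
  moment_const g g 1 t + q.+1%:R * (moment_const g 1 0 t +
    moment_const g g 0 t + moment_const g (g ^+ 2) 0 t).

Section SecondMoment.
Context {N : nat} {A : 'M[R]_N} {gamma : R}.
Context (Asym : A^T = A) (Adiag : forall i, A i i = 0).
Context (Age0 : forall i j, 0 <= A i j).
Context (Abound : forall i, row_sum A i <= gamma) (N0 : (0 < N)%N).

Lemma lipschitz_local_field :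
  lipschitz_family A gamma 1
    (fun i (y : config q.+1 N) r => local_field A y i r).
Proof.
split=> [i y r|i j y s r]; last by rewrite mul1r local_field_recolor_lip.
by rewrite ger0_norm ?local_field_ge0 ?local_field_le.
Qed.

Lemma lipschitz_color_weight w W (s : 'I_q.+1) : (forall i, `|w i| <= W) ->
  lipschitz_family A W 0 (color_weight w s).
Proof.
move=> hw; split=> [i y r|i j y u r]; rewrite /color_weight.
  apply: le_trans (hw i); rewrite normrM ler_piMr //.
  by case: (r == s); rewrite ?normr1 ?normr0.
by rewrite subrr normr0 mul0r.
Qed.

Lemma color_weight_second_moment w W t :
    0 <= W -> (forall i, `|w i| <= W) ->
  potts_mean A t
    (fun x => \sum_s residual A t (color_weight w s) x ^+ 2) <=
  q.+1%:R * moment_const gamma W 0 t * N%:R.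
Proof.
move=> W0 hw; rewrite /potts_mean.
under eq_bigr do rewrite mulr_sumr.
rewrite exchange_big /= -mulrA mulr_natl -[X in _ *+ X](card_ord q.+1).
rewrite -sumr_const.
apply: ler_sum => s _.
exact: (residual_second_moment Asym Adiag Age0 Abound t
  (lipschitz_color_weight s hw) ord_max W0 (lexx 0)).
Qed.

Lemma residual_energy_mean_le t :
  potts_mean A t (residual_energy A t) <= residual_energy_const gamma t * N%:R.
Proof.
have g0 := gamma_ge0 Age0 Abound N0.
have h0 := residual_second_moment Asym Adiag Age0 Abound t
  lipschitz_local_field ord_max g0 ler01.
have h1 : potts_mean A t
    (fun x => \sum_s residual A t (color_weight (fun=> 1) s) x ^+ 2) <=
    q.+1%:R * moment_const gamma 1 0 t * N%:R.
  by apply: color_weight_second_moment => // i; rewrite normr1.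
have h2 := color_weight_second_moment t g0 (row_sum_norm_le Age0 Abound).
have h3 := color_weight_second_moment t (sqr_ge0 gamma)
  (centered_weight_norm_le Asym Age0 Abound N0).
have -> : potts_mean A t (residual_energy A t) =
  potts_mean A t (fun x =>
    residual A t (fun i y r => local_field A y i r) x ^+ 2) +
  potts_mean A t (fun x =>
    \sum_s residual A t (color_weight (fun=> 1) s) x ^+ 2) +
  potts_mean A t (fun x =>
    \sum_s residual A t (color_weight (row_sum A) s) x ^+ 2) +
  potts_mean A t (fun x =>
    \sum_s residual A t (color_weight (centered_weight A) s) x ^+ 2).
  rewrite /potts_mean -!big_split /=; apply: eq_bigr => x _.
  by rewrite -!mulrDr.
apply: le_trans (lerD (lerD (lerD h0 h1) h2) h3) _.
rewrite le_eqVlt; apply/orP; left; apply/eqP.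
by rewrite /residual_energy_const /moment_const; ring.
Qed.

Lemma residual_energy_ge0 t (x : config q.+1 N) : 0 <= residual_energy A t x.
Proof.
rewrite /residual_energy !addr_ge0 ?sqr_ge0 //.
all: by apply: sumr_ge0 => s _; apply: sqr_ge0.
Qed.

(** Contrapositive of [ext_field_le_tau]: the energy bound makes each residual at most [tau * N], so
    a smaller variance would force the field at [r] below its value. *)
Lemma gap_variance_ge delta tau t (x : config q.+1 N) r :
    0 < delta -> delta <= average (fun i => centered_row_sum A i ^+ 2) ->
    0 < tau -> residual_energy A t x <= tau ^+ 2 * N%:R ^+ 2 ->
    field_const gamma delta t * tau < `|ext_field t.2 r| ->
  tau ^+ 2 <= gap_variance A x.
Proof.
move=> d0 hd tau0 hE hB; rewrite leNgt; apply/negP => /ltW hv.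
have key (S : R) : 0 <= residual_energy A t x - S ^+ 2 -> `|S| <= tau * N%:R.
  move=> hS; rewrite -ler_sqr ?nnegrE ?mulr_ge0 //; last exact: ltW.
  by rewrite real_normK ?num_real // exprMn; lra.
suff : `|ext_field t.2 r| <= field_const gamma delta t * tau.
  by rewrite leNgt hB.
have nn w : 0 <= \sum_s residual A t (color_weight w s) x ^+ 2.
  by apply: sumr_ge0 => s _; apply: sqr_ge0.
have one w s : residual A t (color_weight w s) x ^+ 2 <=
    \sum_s residual A t (color_weight w s) x ^+ 2.
  rewrite [leRHS](bigD1 s) //= lerDl.
  by apply: sumr_ge0 => u _; apply: sqr_ge0.
have a0 := sqr_ge0 (residual A t (fun i y r => local_field A y i r) x).
apply: (ext_field_le_tau Asym Age0 Abound N0 d0 hd tau0 hv) => s; apply: key;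
  rewrite /residual_energy.
  have := one (row_sum A) s; have := nn (fun=> 1).
  have := nn (centered_weight A).
  by move=> *; lra.
have := one (centered_weight A) s; have := nn (fun=> 1); have := nn (row_sum A).
by move=> *; lra.
Qed.

End SecondMoment.

(** [K] and the threshold on [N] are uniform in [A] and [x], so that randomness enters only through
    the size of the residual energy. *)
Lemma unique_maximizer_eventually_near gamma delta t r M :
    0 <= gamma -> 0 < delta -> ext_field t.2 r != 0 -> 0 < M ->
  exists2 K : R, 0 < K & \forall N \near \oo,
    forall (A : 'M[R]_N) (x : config q.+1 N),
      A^T = A -> (forall i j, 0 <= A i j) -> (forall i, row_sum A i <= gamma) ->
      delta <= average (fun i => centered_row_sum A i ^+ 2) ->
      residual_energy A t x <= M * N%:R ->
    exists p, unique (is_maximizer (log_pl A x)) p /\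
      norm2 (displacement t p) <= K / Num.sqrt N%:R.
Proof.
move=> g0 d0 Br M0.
have B0 : 0 < `|ext_field t.2 r| by rewrite normr_gt0.
(* [C] is positive and exceeds [field_const] whatever the sign of the latter, so that
   [field_const * tau] stays below the field at [r]. *)
pose C := `|field_const gamma delta t| + 1.
have C0 : 0 < C by rewrite ltr_wpDl.
pose tau := `|ext_field t.2 r| / C.
have tau0 : 0 < tau by rewrite divr_gt0.
have htau : field_const gamma delta t * tau < `|ext_field t.2 r|.
  rewrite -[ltRHS](divfK (lt0r_neq0 C0)) mulrC ltr_pM2l //.
  by apply: le_lt_trans (ler_norm _) _; rewrite ltrDl.
have t20 : 0 < tau ^+ 2 by rewrite exprn_gt0.
have k0 : 0 < curvature gamma (tau ^+ 2) t.
  have c0 : 0 < cond_law_min gamma t by rewrite divr_gt0 ?expR_gt0.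
  apply: divr_gt0; first by apply: divr_gt0 => //; rewrite mulr_gt0 ?ltr0n.
  rewrite /identifiability_const ltr_pwDl // divr_ge0 ?ltW //.
  by rewrite ltr_wpDl // mulr_ge0 // mulr_ge0 // sqr_ge0.
(* Makes [curvature * K] equal to [2 * M + 1], whose square exceeds [2 * M]. *)
pose K := (2 * M + 1) / curvature gamma (tau ^+ 2) t.
have K0 : 0 < K by rewrite divr_gt0 //; lra.
have hK : 2 * M < (curvature gamma (tau ^+ 2) t * K) ^+ 2.
  have -> : curvature gamma (tau ^+ 2) t * K = 2 * M + 1.
    by rewrite /K mulrC divfK // gt_eqF.
  by nra.
exists K => //; near=> N => A x Asym Age0 Abound hd hE.
have N0 : (0 < N)%N by near: N; exact: nbhs_infty_gt.
have Np : 0 < N%:R :> R by rewrite ltr0n.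
have s0 : 0 < Num.sqrt N%:R :> R by rewrite sqrtr_gt0.
(* The first threshold bounds [M * N] by [tau ^+ 2 * N ^+ 2]; the second makes the sphere small
   enough for [log_pl_lt_sphere]. *)
have hN1 : M / tau ^+ 2 <= N%:R by near: N; exact: nbhs_infty_ger.
have hN2 : (K * (gamma + 1)) ^+ 2 <= N%:R by near: N; exact: nbhs_infty_ger.
have hv : tau ^+ 2 <= gap_variance A x.
  apply: (gap_variance_ge Asym Age0 Abound N0 d0 hd tau0 _ htau).
  apply: le_trans hE _; rewrite [N%:R ^+ 2]expr2 mulrA (ler_wpM2r (ltW Np)) //.
  by rewrite mulrC -ler_pdivrMr.
apply: unique_maximizer_near; first by rewrite divr_gt0.
- move=> u hu; apply: (log_pl_lt_sphere Age0 Abound N0 t20 hv K0 hE hK).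
    by rewrite hu expr_div_n sqr_sqrtr.
  have K1 : 0 <= K * (gamma + 1) by rewrite mulr_ge0 ?addr_ge0 // ltW.
  rewrite hu mulrAC ler_pdivrMr // mul1r -ler_sqr ?nnegrE ?(ltW s0) //.
  by rewrite sqr_sqrtr.
- move=> u; apply: (identifiable_of_variance Age0 Abound N0).
  exact: lt_le_trans hv.
Unshelve. all: by end_near. Qed.

End Assembly.

(** * Uniform real bounds from the extended-real hypotheses, and the theorem *)

Lemma limn_einf_gt0 (R : realType) (u : nat -> R) :
  (0 < limn_einf (fun n => (u n)%:E))%E ->
  exists2 d : R, 0 < d & \forall n \near \oo, d <= u n.
Proof.
(* The limit inferior is the supremum of the nondecreasing tail infima, so one of them is already
   positive. *)
rewrite limn_einf_lim.
rewrite (cvg_lim _ (ereal_nondecreasing_cvgn (nondecreasing_einfs _))) //.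
move=> /ereal_sup_gt[_ [n _ <-]]; set m := einfs _ n => m0.
have le_u k : (n <= k)%N -> (m <= (u k)%:E)%E.
  by move=> nk; apply: ereal_inf_lbound; exists k.
case: m m0 le_u => [d|_ /(_ n (leqnn n))|] //.
by rewrite lte_fin => d0 hd; exists d => //; exists n.
Qed.

Lemma ereal_sup_row_sum_bound (R : realType) (A : forall N, 'M[R]_N) :
    (forall N (i j : 'I_N), 0 <= A N i j) ->
    (ereal_sup [set (\big[Num.max/0]_(i < N) row_sum (A N) i)%:E
       | N in [set N : nat | (1 <= N)%N]] < +oo)%E ->
  exists2 g : R, 0 <= g & forall N (i : 'I_N), row_sum (A N) i <= g.
Proof.
move=> Age0; set S := ereal_sup _ => hS.
have ub N : (1 <= N)%N ->
    ((\big[Num.max/0]_(i < N) row_sum (A N) i)%:E <= S)%E.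
  by move=> N1; apply: ereal_sup_ubound; exists N.
(* The maximum over the sites starts from 0; nonnegativity and the hypothesis make [S] finite. *)
have S0 : (0 <= S)%E.
  apply: le_trans (ub 1 isT); rewrite lee_fin.
  exact: bigmax_ge_id.
have Sfin : S \is a fin_num by rewrite ge0_fin_numE.
exists (fine S); first by rewrite fine_ge0.
move=> N i; rewrite -lee_fin fineK //; apply: le_trans (ub N _).
  by rewrite lee_fin; apply: le_bigmax.
by apply: leq_ltn_trans (ltn_ord i).
Qed.

Theorem theorem1p4 (R : realType) (q : nat) (hq : (2 <= q)%N)
    (A : forall N : nat, 'M[R]_N)
    (Asym : forall N, (A N)^T = A N)
    (Adiag : forall N (i : 'I_N), A N i i = 0)
    (Age0 : forall N (i j : 'I_N), 0 <= A N i j)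
    (beta : R) (hbeta : 0 < beta) (B : 'rV[R]_q.-1) (hB : B != 0)
    (Abounded : (ereal_sup
       [set (\big[Num.max/0]_(i < N) row_sum (A N) i)%:E
         | N in [set N : nat | (1 <= N)%N]] < +oo)%E)
    (Adense : (0 < limn_einf (fun N : nat =>
       (N%:R^-1 * \sum_(i < N) \sum_(j < N) A N i j)%:E))%E)
    (Airregular : (0 < limn_einf (fun N : nat =>
       (N%:R^-1 * \sum_(i < N)
          (row_sum (A N) i - mean_row_sum (A N)) ^+ 2)%:E))%E)
    (est : forall N : nat, config q N -> param R q)
    (hest : is_MPL A est) :
  bigO_prob (fun N (x : config q N) => potts_pmf (A N) (beta, B) x)
    (fun N (x : config q N) =>
       norm2 ((est N x).1 - beta, (est N x).2 - B))
    (fun N : nat => (Num.sqrt N%:R)^-1).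
Proof.
case: q hq B hB est hest => // q _ B hB est hest e e0.
have [g g0 hg] := ereal_sup_row_sum_bound Age0 Abounded.
have [d d0 hd] := limn_einf_gt0 Airregular.
pose t : param R q.+1 := (beta, B).
have [r hr] : exists r : 'I_q.+1, ext_field t.2 r != 0.
  apply: contrapT => no; move/negP: hB; apply; apply/eqP/rowP => k.
  have hk : (k < q.+1)%N by rewrite (leq_trans (ltn_ord k)).
  rewrite mxE; apply/eqP/negPn/negP => Bk; apply: no.
  exists (Ordinal hk); rewrite /ext_field; case: insubP => [j _ jk|].
    by rewrite (_ : j = k) //; apply: val_inj.
  by rewrite /= ltn_ord.
(* Chosen so that Markov's inequality leaves at most [residual_energy_const g t / M <= e]; the added
   1 keeps [M] positive. *)
pose M := `|residual_energy_const g t| / e + 1.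
have M0 : 0 < M by rewrite ltr_wpDl // divr_ge0 // ltW.
have [K K0 hK] := unique_maximizer_eventually_near g0 d0 hr M0.
exists K => //; near=> N.
have N0 : (0 < N)%N by near: N; exact: nbhs_infty_gt.
have Np : 0 < N%:R :> R by rewrite ltr0n.
have dN : d <= average (fun i => centered_row_sum (A N) i ^+ 2).
  by near: N; apply: hd.
(* On this event a unique maximizer exists, so [hest] identifies the estimator with it; off the
   event nothing is asked of the estimator. *)
have near_mle (x : config q.+1 N) : residual_energy (A N) t x <= M * N%:R ->
    norm2 ((est N x).1 - beta, (est N x).2 - B) <= K / Num.sqrt N%:R.
  move=> hE; have hKN := near hK N.
  have [|p [p_max hp]] := hKN _ (A N) x (Asym N) (Age0 N) (hg N) dN hE.
    by [].
  by rewrite (hest N x p p_max).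
apply: (@le_trans _ _ (prob (fun x => potts_pmf (A N) t x)
    (fun x => M * N%:R < residual_energy (A N) t x))).
  rewrite /prob [leLHS]big_mkcond [leRHS]big_mkcond; apply: ler_sum => x _.
  case: ifP => [far|_]; last by case: ifP => // _; apply: potts_pmf_ge0.
  case: ifP => // /negbT; rewrite -leNgt => /near_mle close.
  by move: far; rewrite ger0_norm ?norm2_ge0 // ltNge close.
apply: le_trans (potts_markov (A N) t _ _) _.
- by rewrite mulr_gt0.
- by move=> x; apply: residual_energy_ge0.
rewrite ler_pdivrMr ?mulr_gt0 //.
apply: le_trans
  (residual_energy_mean_le (Asym N) (Adiag N) (Age0 N) (hg N) N0 t) _.
rewrite mulrA (ler_wpM2r (ltW Np)) // /M mulrDr mulr1 mulrCA divff ?gt_eqF //.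
rewrite mulr1.
by apply: le_trans (ler_norm _) _; rewrite lerDl ltW.
Unshelve. all: by end_near. Qed.
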